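(* Let $\alpha>0$ and $\beta>0$, and let $\pi=\mathrm{PBD}(\alpha;0,\beta,1)$. For each $f\in\mathcal{F}$, let $g_f:\mathbb{Z}_+\to\mathbb{R}$ be the solution of Stein's equation $$\alpha\, g_f(i+1)-[\beta i+i(i-1)]\,g_f(i)=f(i)-\pi(f),\qquad i\in\mathbb{Z}_+,$$ with the convention $g_f(0)=g_f(1)$. Then $$\sup_{f\in\mathcal{F}}\|g_f\|=\frac1\alpha\sum_{k=1}^\infty k\pi_k\le \min\left\{\frac{1}{\beta+\frac{2\alpha}{\alpha+2\beta+2}},\ \frac{\sqrt{\alpha+(1-\beta)^2/4}+(1-\beta)/2}{\alpha}\right\},$$ $$\sup_{f\in\mathcal{F}}\|\Delta g_f\|\le \min\left\{\frac{1}{\beta+1}+\frac{\alpha+2}{\alpha(\alpha+2)+2\beta(\alpha+\beta+1)},\ \frac{1}{\sqrt{\alpha}}+\frac1\alpha\right\},$$ $$\sup_{f\in\mathcal{F}}\|\Delta^2 g_f\|\le \frac{2}{\alpha}+\frac{1}{\alpha+\beta(1+\beta+\alpha/2)}\le\frac{3}{\alpha}.$$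
   Context: $\mathbb{Z}_+=\{0,1,2,\dots\}$. $\mathcal{F}$ is the set of functions $f:\mathbb{Z}_+\to\mathbb{R}$ with $|f(x)-f(y)|\le|x-y|$ for all $x,y\in\mathbb{Z}_+$. For a function $g$ on $\mathbb{Z}_+$, $\Delta g(i)=g(i+1)-g(i)$, $\Delta^2 g=\Delta(\Delta g)$, and $\|g\|=\sup_{i\in\mathbb{Z}_+}|g(i)|$. The polynomial birth-death distribution $\mathrm{PBD}(\alpha;0,\beta,1)$ is the probability distribution $\pi=(\pi_n)_{n\in\mathbb{Z}_+}$ on $\mathbb{Z}_+$ given by $$\pi_n=\frac{\prod_{i=0}^{n-1}\alpha_i}{\prod_{i=1}^n\beta_i}\left(1+\sum_{j=1}^\infty\frac{\prod_{i=0}^{j-1}\alpha_i}{\prod_{i=1}^j\beta_i}\right)^{-1},\qquad \alpha_i=\alpha,\quad \beta_i=\beta i+i(i-1).$$ For a function $f$ with $\sum_i|f(i)|\pi_i<\infty$, $\pi(f)=\sum_{i=0}^\infty f(i)\pi_i$. *)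

(* Defs.v *)
From Stdlib Require Import Reals Lra Lia Psatz.
From Coquelicot Require Import Coquelicot.
Open Scope R_scope.

(* [rprod u n] is u 0 * ... * u (n - 1). *)
Fixpoint rprod (u : nat -> R) (n : nat) : R :=
  match n with
  | O => 1
  | S m => rprod u m * u m
  end.

Definition bd_weight (a b : nat -> R) (n : nat) : R :=
  rprod a n / rprod (fun i => b (S i)) n.

Definition bd_dist (a b : nat -> R) (n : nat) : R :=
  bd_weight a b n * / (1 + Series (fun j => bd_weight a b (S j))).

Definition birth_rate (alpha : R) (i : nat) : R := alpha.

Definition death_rate (beta : R) (i : nat) : R :=
  beta * INR i + INR i * (INR i - 1).

(* PBD(alpha; 0, beta, 1) *)
Definition pbd (alpha beta : R) : nat -> R :=
  bd_dist (birth_rate alpha) (death_rate beta).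

Definition expect (p f : nat -> R) : R := Series (fun i => f i * p i).

Definition Lip1 (f : nat -> R) : Prop :=
  forall x y : nat, Rabs (f x - f y) <= Rabs (INR x - INR y).

Definition fwd_diff (g : nat -> R) (i : nat) : R := g (S i) - g i.

Definition sup_norm (g : nat -> R) : Rbar :=
  Sup_seq (fun i => Finite (Rabs (g i))).

Definition sup_Lip1 (h : (nat -> R) -> Rbar) : Rbar :=
  Rbar_lub (fun y => exists f, Lip1 f /\ y = h f).

Definition stein_solution (alpha beta : R) (f g : nat -> R) : Prop :=
  g 0%nat = g 1%nat /\
  forall i : nat,
    birth_rate alpha i * g (S i) - death_rate beta i * g i
      = f i - expect (pbd alpha beta) f.

(* [Series] is a total function.  The lemmas below show that every series
   used above converges, and that Stein's equation has exactly one solution. *)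

Lemma death_rate_S_ge (beta : R) (n : nat) : 0 < beta ->
  beta * INR (S n) <= death_rate beta (S n).
Proof.
  intros Hb; unfold death_rate; rewrite S_INR.
  pose proof (pos_INR n); nra.
Qed.

Lemma death_rate_S_pos (beta : R) (n : nat) : 0 < beta ->
  0 < death_rate beta (S n).
Proof.
  intros Hb; apply Rlt_le_trans with (2 := death_rate_S_ge beta n Hb).
  apply Rmult_lt_0_compat; [assumption | apply lt_0_INR; lia].
Qed.

Lemma rprod_pos (u : nat -> R) (n : nat) :
  (forall i, 0 < u i) -> 0 < rprod u n.
Proof.
  intros Hu; induction n as [|n IH]; simpl; [lra|].
  now apply Rmult_lt_0_compat.
Qed.

Lemma pbd_weight_pos (alpha beta : R) (n : nat) : 0 < alpha -> 0 < beta ->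
  0 < bd_weight (birth_rate alpha) (death_rate beta) n.
Proof.
  intros Halpha Hbeta.
  apply Rdiv_lt_0_compat; apply rprod_pos; intros i.
  - exact Halpha.
  - now apply death_rate_S_pos.
Qed.

Lemma pbd_weight_S (alpha beta : R) (n : nat) : 0 < beta ->
  bd_weight (birth_rate alpha) (death_rate beta) (S n)
  = bd_weight (birth_rate alpha) (death_rate beta) n
    * (alpha / death_rate beta (S n)).
Proof.
  intros Hbeta.
  unfold bd_weight; simpl rprod; unfold birth_rate at 2; field; split.
  - now apply Rgt_not_eq, death_rate_S_pos.
  - apply Rgt_not_eq, rprod_pos; intros i; now apply death_rate_S_pos.
Qed.

Lemma ex_series_pbd_weight_mean (alpha beta : R) : 0 < alpha -> 0 < beta ->
  ex_series (fun n =>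
    INR (S n) * bd_weight (birth_rate alpha) (death_rate beta) n).
Proof.
  intros Halpha Hbeta.
  set (w := bd_weight (birth_rate alpha) (death_rate beta)).
  assert (Hpos : forall n, 0 < INR (S n) * w n).
  { intros n; apply Rmult_lt_0_compat;
      [apply lt_0_INR; lia | now apply pbd_weight_pos]. }
  apply ex_series_ext with (fun n => Rabs (INR (S n) * w n)).
  { intros n; apply Rabs_pos_eq, Rlt_le, Hpos. }
  apply ex_series_DAlembert with 0; [lra | |].
  { intros n; apply Rgt_not_eq, Hpos. }
  apply is_lim_seq_le_le with (fun _ => 0)
    (fun n => 2 * alpha / beta * / INR (S n)).
  - intros n; split; [apply Rabs_pos|].
    rewrite Rabs_pos_eq by (apply Rlt_le, Rdiv_lt_0_compat; apply Hpos).
    unfold w at 1; rewrite pbd_weight_S by assumption; fold w.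
    assert (Hn : 0 < INR (S n)) by (apply lt_0_INR; lia).
    assert (Hd := death_rate_S_pos beta n Hbeta).
    assert (Hw : 0 < w n) by now apply pbd_weight_pos.
    replace (INR (S (S n)) * (w n * (alpha / death_rate beta (S n)))
             / (INR (S n) * w n))
      with ((INR (S (S n)) / INR (S n)) * alpha * / death_rate beta (S n))
      by (field; repeat split; lra).
    replace (2 * alpha / beta * / INR (S n))
      with (2 * alpha * / (beta * INR (S n))) by (field; lra).
    assert (Hr : 0 < INR (S (S n)) / INR (S n) <= 2).
    { split; [apply Rdiv_lt_0_compat; [apply lt_0_INR; lia | assumption]|].
      apply Rle_div_l; [assumption|].
      rewrite !S_INR; pose proof (pos_INR n); lra. }
    apply Rmult_le_compat.
    + apply Rlt_le, Rmult_lt_0_compat; lra.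
    + now apply Rlt_le, Rinv_0_lt_compat.
    + apply Rmult_le_compat_r; lra.
    + apply Rinv_le_contravar;
        [now apply Rmult_lt_0_compat | now apply death_rate_S_ge].
  - apply is_lim_seq_const.
  - replace (Finite 0) with (Rbar_mult (2 * alpha / beta) 0)
      by (simpl; f_equal; ring).
    apply (is_lim_seq_scal_l _ _ (Finite 0)).
    apply (is_lim_seq_incr_1 (fun n => / INR n)).
    apply (is_lim_seq_inv INR p_infty); [apply is_lim_seq_INR | discriminate].
Qed.

Lemma ex_series_pbd_normalizer (alpha beta : R) : 0 < alpha -> 0 < beta ->
  ex_series (fun j =>
    bd_weight (birth_rate alpha) (death_rate beta) (S j)).
Proof.
  intros Halpha Hbeta.
  set (w := bd_weight (birth_rate alpha) (death_rate beta)).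
  apply (ex_series_incr_1 w).
  refine (@ex_series_le R_AbsRing R_CompleteNormedModule w _ _
            (ex_series_pbd_weight_mean alpha beta Halpha Hbeta)).
  intros n; unfold norm; simpl; unfold abs; simpl.
  assert (Hw : 0 < w n) by now apply pbd_weight_pos.
  rewrite Rabs_pos_eq by lra.
  change (w n <= INR (S n) * w n).
  rewrite S_INR; pose proof (pos_INR n); nra.
Qed.

Lemma pbd_normalizer_pos (alpha beta : R) : 0 < alpha -> 0 < beta ->
  0 < 1 + Series (fun j =>
    bd_weight (birth_rate alpha) (death_rate beta) (S j)).
Proof.
  intros Halpha Hbeta.
  apply Rplus_lt_le_0_compat; [lra|].
  replace 0 with (Series (fun _ => 0 * 0)) by (rewrite Series_scal_l; ring).
  apply Series_le; [|now apply ex_series_pbd_normalizer].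
  intros m; rewrite Rmult_0_l; split; [lra | now apply Rlt_le, pbd_weight_pos].
Qed.

Lemma pbd_pos (alpha beta : R) (n : nat) :
  0 < alpha -> 0 < beta -> 0 < pbd alpha beta n.
Proof.
  intros Halpha Hbeta.
  apply Rmult_lt_0_compat; [now apply pbd_weight_pos|].
  now apply Rinv_0_lt_compat, pbd_normalizer_pos.
Qed.

Lemma pbd_total (alpha beta : R) : 0 < alpha -> 0 < beta ->
  is_series (pbd alpha beta) 1.
Proof.
  intros Halpha Hbeta.
  assert (HS := pbd_normalizer_pos alpha beta Halpha Hbeta).
  assert (Hw := proj2 (ex_series_incr_1 _)
    (ex_series_pbd_normalizer alpha beta Halpha Hbeta)).
  unfold pbd, bd_dist; set (w := bd_weight _ _) in *.
  assert (Heq : Series w * / (1 + Series (fun j => w (S j))) = 1).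
  { rewrite (Series_incr_1 w Hw).
    replace (w 0%nat) with 1 by (unfold w, bd_weight; simpl; field).
    field; lra. }
  assert (H := is_series_scal_r (/ (1 + Series (fun j => w (S j)))) w _
                 (Series_correct w Hw)).
  now rewrite Heq in H.
Qed.

Lemma ex_series_Lip1_pbd (alpha beta : R) (f : nat -> R) :
  0 < alpha -> 0 < beta -> Lip1 f ->
  ex_series (fun i => Rabs (f i) * pbd alpha beta i).
Proof.
  intros Halpha Hbeta.
  set (w := bd_weight (birth_rate alpha) (death_rate beta)).
  intros Hf.
  set (c := / (1 + Series (fun j => w (S j)))).
  refine (@ex_series_le R_AbsRing R_CompleteNormedModule _
            (fun n => (Rabs (f 0%nat) + 1) * (INR (S n) * w n * c)) _ _).
  - intros n; unfold norm; simpl; unfold abs; simpl.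
    assert (Hp := pbd_pos alpha beta n Halpha Hbeta).
    rewrite Rabs_pos_eq
      by (apply Rmult_le_pos; [apply Rabs_pos | lra]).
    change (match n with O => 1 | S _ => INR n + 1 end) with (INR (S n)).
    replace ((Rabs (f 0%nat) + 1) * (INR (S n) * w n * c))
      with ((Rabs (f 0%nat) + 1) * INR (S n) * pbd alpha beta n)
      by (unfold pbd, bd_dist, c, w; ring).
    apply Rmult_le_compat_r; [lra|].
    assert (H := Hf n 0%nat); simpl in H.
    rewrite Rminus_0_r, (Rabs_pos_eq (INR n)) in H by apply pos_INR.
    assert (H2 := Rabs_triang (f n - f 0%nat) (f 0%nat)).
    replace (f n - f 0%nat + f 0%nat) with (f n) in H2 by ring.
    rewrite S_INR; pose proof (pos_INR n);
      pose proof (Rabs_pos (f 0%nat)); nra.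
  - apply (ex_series_scal_l (Rabs (f 0%nat) + 1)
             (fun n => INR (S n) * w n * c)).
    apply (ex_series_scal_r c (fun n => INR (S n) * w n)).
    now apply ex_series_pbd_weight_mean.
Qed.

Lemma ex_series_pbd_mean (alpha beta : R) : 0 < alpha -> 0 < beta ->
  ex_series (fun k => INR (S k) * pbd alpha beta (S k)).
Proof.
  intros Halpha Hbeta.
  apply (ex_series_incr_1 (fun k => INR k * pbd alpha beta k)).
  apply ex_series_ext with (fun k => Rabs (INR k) * pbd alpha beta k).
  { intros n; rewrite Rabs_pos_eq by apply pos_INR; reflexivity. }
  apply ex_series_Lip1_pbd; try assumption; intros x y; apply Rle_refl.
Qed.

Lemma stein_solution_exists (alpha beta : R) (f : nat -> R) :
  0 < alpha -> exists g, stein_solution alpha beta f g.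
Proof.
  intros Ha.
  set (e := expect (pbd alpha beta) f).
  exists (fix g n := match n with
    | O => (f 0%nat - e) / alpha
    | S m => match m with
             | O => (f 0%nat - e) / alpha
             | S _ => (f m - e + death_rate beta m * g m) / alpha
             end
    end).
  split; [reflexivity|].
  intros [|i]; fold e; unfold birth_rate.
  - unfold death_rate; simpl; field; lra.
  - field; lra.
Qed.

Lemma stein_solution_unique (alpha beta : R) (f g h : nat -> R) :
  0 < alpha -> stein_solution alpha beta f g ->
  stein_solution alpha beta f h -> forall i, g i = h i.
Proof.
  intros Ha [Hg0 Hg] [Hh0 Hh].
  assert (H : forall i, g i = h i -> g (S i) = h (S i)).
  { intros i E; specialize (Hg i); specialize (Hh i); unfold birth_rate in *.
    rewrite E in Hg; apply Rmult_eq_reg_l with alpha; lra. }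
  assert (H1 : g 1%nat = h 1%nat).
  { specialize (Hg 0%nat); specialize (Hh 0%nat).
    unfold birth_rate, death_rate in *; simpl in *.
    apply Rmult_eq_reg_l with alpha; lra. }
  intros [|i]; [congruence|].
  induction i as [|i IH]; auto.
Qed.

(* Main.v *)
(* Write [B i] for the death rates, [pi] for the stationary law, [X] for a
   variable with law [pi], and [F], [T] for its distribution function and tail.
   Solving the equation gives, for each [i] and with [f] centered at [f i],
     alpha g_f(i+1) = (T/pi)(i) E[f(X); X <= i] - (F/pi)(i) E[f(X); X > i].
   Since [F/pi] is increasing and convex and [T/pi] is decreasing and convex,
   the 1-Lipschitz functions maximizing [g], [Delta g] and [Delta^2 g] at a given
   point are explicit, and the suprema are expressed through the solution [h]
   for [f k = - k]:
     |g_f| <= h,  |Delta g_f| <= |Delta h| + 2 P,  |Delta^2 g_f| <= Delta^2 h + 2/alpha.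
   The shifted solution [i |-> h(i+1)] satisfies [L_1 h = -1], where [L_c] is the
   birth-death generator killed at rate [c (B (i+1) - B i)].  Because [B] has constant
   second difference, differencing turns [L_c] into [L_(c+1)] with a source of
   the same sign, so the maximum principle makes the first three differences
   of [h] alternate in sign.  Hence [h], [|Delta h|] and [Delta^2 h] are largest
   at the left end, where they are affine functions of [E X]; the bounds on [E X]
   come from the recursion
     alpha E[X]_q = (beta + q) E[X]_(q+1) + E[X]_(q+2)
   for the factorial moments.  Finally [P], the contribution of [f k = - (k-i)^+],
   is estimated through [(beta + 2 i) E(X-i)^+ F(i) <= alpha pi(i)]. *)

Require Import Defs.
From Stdlib Require Import Reals Lra Lia Psatz.
From Coquelicot Require Import Coquelicot.
Open Scope R_scope.

(** * Series, absolute values and limits *)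

Lemma ex_series_dominated (u v : nat -> R) :
  (forall n, 0 <= u n <= v n) -> ex_series v -> ex_series u.
Proof.
  intros H Hv; refine (@ex_series_le R_AbsRing R_CompleteNormedModule u v _ Hv).
  intros n; unfold norm; simpl; unfold abs; simpl.
  rewrite Rabs_pos_eq; apply H.
Qed.

Lemma Series_nonneg (u : nat -> R) :
  (forall n, 0 <= u n) -> ex_series u -> 0 <= Series u.
Proof.
  intros H Hu.
  replace 0 with (Series (fun _ => 0 * 0)) by (rewrite Series_scal_l; ring).
  apply Series_le; [|assumption].
  intros n; rewrite Rmult_0_l; split; [lra | apply H].
Qed.

Lemma Series_abs_le (u v : nat -> R) :
  (forall n, Rabs (u n) <= v n) -> ex_series v -> Rabs (Series u) <= Series v.
Proof.
  intros H Hv.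
  assert (Ha : ex_series (fun n => Rabs (u n))).
  { apply ex_series_dominated with v; [|assumption].
    intros n; split; [apply Rabs_pos | apply H]. }
  apply Rle_trans with (1 := Series_Rabs u Ha).
  apply Series_le; [|assumption].
  intros n; split; [apply Rabs_pos | apply H].
Qed.

Lemma Rabs_mult_le (u v w : R) : 0 <= u -> Rabs v <= w -> Rabs (u * v) <= u * w.
Proof.
  intros Hu Hv; rewrite Rabs_mult, (Rabs_pos_eq u) by assumption.
  now apply Rmult_le_compat_l.
Qed.

Lemma Rabs_minus_le (u v a b : R) :
  Rabs u <= a -> Rabs v <= b -> Rabs (u - v) <= a + b.
Proof.
  intros Hu Hv; apply Rle_trans with (1 := Rabs_triang _ _).
  rewrite Rabs_Ropp; lra.
Qed.

Lemma Rle_div_intro_r (a b c : R) : 0 < c -> a * c <= b -> a <= b / c.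
Proof. intros Hc; now apply Rle_div_r. Qed.

Lemma eventually_INR_ge (c : R) : eventually (fun n => c <= INR n).
Proof.
  destruct (INR_unbounded c) as [N HN]; exists N; intros n Hn.
  apply le_INR in Hn; lra.
Qed.

Lemma is_lim_seq_const_div_INR (c : R) : is_lim_seq (fun n => c / INR n) 0.
Proof.
  replace (Finite 0) with (Rbar_mult c 0) by (simpl; f_equal; ring).
  apply (is_lim_seq_scal_l _ c 0).
  apply (is_lim_seq_inv INR p_infty); [apply is_lim_seq_INR | discriminate].
Qed.

Lemma squeeze_const_div_INR (c N : R) (u : nat -> R) :
  (forall n, 0 <= u n) ->
  (forall n, N <= INR n -> INR n * u n <= c) -> is_lim_seq u 0.
Proof.
  intros H0 H.
  apply is_lim_seq_le_le_loc with (fun _ => 0) (fun n => c / INR n).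
  - generalize (filter_and _ _ (eventually_INR_ge N) (eventually_INR_ge 1)).
    apply filter_imp; intros n [H1 H2]; split; [apply H0|].
    apply Rle_div_intro_r; [lra|]; rewrite Rmult_comm; now apply H.
  - apply is_lim_seq_const.
  - apply is_lim_seq_const_div_INR.
Qed.

Lemma Rle_div_intro_l (a b c : R) : 0 < c -> a <= b * c -> a / c <= b.
Proof. intros Hc; now apply Rle_div_l. Qed.

(* Syntactic matching, so that [apply] cannot unfold a quotient into a product. *)
Ltac prod_nonneg :=
  match goal with
  | |- 0 <= _ * _ => apply Rmult_le_pos; prod_nonneg
  | |- _ => lra
  end.

(** * Killed birth-death generators *)

Section Generator.

Variables alpha beta : R.
Hypothesis Halpha : 0 < alpha.
Hypothesis Hbeta : 0 < beta.

Lemma death_rate_0 : death_rate beta 0 = 0.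
Proof. unfold death_rate; simpl; ring. Qed.

Lemma death_rate_S (i : nat) :
  death_rate beta (S i) = death_rate beta i + (beta + 2 * INR i).
Proof. unfold death_rate; rewrite S_INR; ring. Qed.

Lemma death_rate_nonneg (i : nat) : 0 <= death_rate beta i.
Proof.
  destruct i as [|i]; [rewrite death_rate_0; lra|].
  now apply Rlt_le, death_rate_S_pos.
Qed.

(* Birth rate [alpha], death rate [death_rate beta i], and killing rate
   [c (death_rate beta (i + 1) - death_rate beta i)]; at [i = 0] the death
   term vanishes because [pred 0 = 0]. *)
Definition killed_gen (c : R) (u : nat -> R) (i : nat) : R :=
  alpha * (u (S i) - u i) + death_rate beta i * (u (pred i) - u i)
  - c * (beta + 2 * INR i) * u i.

(* A first negative value would be followed by ever smaller ones. *)
Lemma killed_gen_nonneg (c : R) (u : nat -> R) :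
  0 <= c -> is_lim_seq u 0 -> (forall i, killed_gen c u i <= 0) ->
  forall n, 0 <= u n.
Proof.
  intros Hc Hlim Hu n.
  destruct (Rle_or_lt 0 (u n)) as [|Hn]; [assumption|exfalso].
  (* Walk left from [n] while [u] stays negative and below its right neighbour; at [0] the second
     condition is trivial because [pred 0 = 0]. *)
  assert (Hex : exists i, u i < 0 /\ u i <= u (pred i)).
  { induction n as [|n IH].
    - exists 0%nat; simpl; lra.
    - destruct (Rle_or_lt (u (S n)) (u n)) as [Hle|Hlt].
      + exists (S n); simpl; lra.
      + apply IH; lra. }
  destruct Hex as [i [Hi0 Hi1]].
  (* Where [u j] is negative and at most its left neighbour, the death and killing terms are
     nonnegative, so the birth term cannot be positive. *)
  assert (Hstep : forall j, u j < 0 -> u j <= u (pred j) -> u (S j) <= u j).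
  { intros j H0 H1; specialize (Hu j); unfold killed_gen in Hu.
    assert (Hd := death_rate_nonneg j); assert (Hj := pos_INR j).
    assert (H2 : 0 <= death_rate beta j * (u (pred j) - u j))
      by (apply Rmult_le_pos; lra).
    assert (H3 : 0 <= c * (beta + 2 * INR j) * - u j)
      by prod_nonneg.
    apply Rmult_le_reg_l with alpha; lra. }
  assert (Hall : forall k, u (k + i)%nat <= u i /\
                           u (k + i)%nat <= u (pred (k + i))).
  { induction k as [|k [IH1 IH2]]; simpl; [lra|].
    assert (H := Hstep (k + i)%nat ltac:(lra) IH2); lra. }
  assert (Hle : Rbar_le 0 (u i)).
  { apply (is_lim_seq_le (fun k => u (k + i)%nat) (fun _ => u i) 0 (u i)).
    - intros k; apply Hall.
    - now apply is_lim_seq_incr_n.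
    - apply is_lim_seq_const. }
  simpl in Hle; lra.
Qed.

(** Minus the forward difference: alternating signs of successive differences become nonnegativity
    of the iterates of [decr]. *)
Definition decr (u : nat -> R) (i : nat) : R := u i - u (S i).

(** Subtract the equation at [i + 1] from the one at [i]. The increment [beta + 2 i] of the death
    rate joins the killing rate, raising [c] by one, and the increment [2] of [beta + 2 i] leaves
    the source [2 c u (i + 1)]. *)
Lemma killed_gen_decr (c : R) (u s : nat -> R) :
  (forall i, killed_gen c u i = - s i) ->
  forall i, killed_gen (c + 1) (decr u) i = - (decr s i + 2 * c * u (S i)).
Proof.
  intros H i.
  assert (H0 := H i); assert (H1 := H (S i)).
  unfold killed_gen, decr in *.
  rewrite death_rate_S, S_INR in H1.
  replace (- (s i - s (S i) + 2 * c * u (S i)))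
    with (- s i - - s (S i) - 2 * c * u (S i)) by ring.
  rewrite <- H0, <- H1.
  destruct i as [|i]; simpl pred; [rewrite death_rate_0; simpl INR|]; ring.
Qed.

Lemma is_lim_seq_decr (u : nat -> R) :
  is_lim_seq u 0 -> is_lim_seq (decr u) 0.
Proof.
  intros H; replace 0 with (0 - 0) by ring.
  apply is_lim_seq_minus'; [assumption|].
  now apply is_lim_seq_incr_1 in H.
Qed.

Lemma decr_nonneg_antitone (u : nat -> R) :
  (forall i, 0 <= decr u i) -> forall n, u n <= u 0%nat.
Proof.
  intros H n; induction n as [|n IH]; [lra|].
  specialize (H n); unfold decr in H; lra.
Qed.


(** * Tails of the stationary distribution *)

Local Notation p := (pbd alpha beta).

(** Detailed balance. *)
Lemma pbd_S (i : nat) :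
  death_rate beta (S i) * pbd alpha beta (S i) = alpha * pbd alpha beta i.
Proof.
  unfold pbd, bd_dist; rewrite pbd_weight_S by assumption.
  assert (H := death_rate_S_pos beta i Hbeta).
  field; split; [|lra].
  apply Rgt_not_eq, pbd_normalizer_pos; assumption.
Qed.

Definition tail_prob (i : nat) : R := Series (fun k => p (S i + k)).

(** [E (X - i)^+]: the point [S i + k] exceeds [i] by [S k]. *)
Definition tail_mean (i : nat) : R :=
  Series (fun k => INR (S k) * p (S i + k)).

Definition cdf (i : nat) : R := 1 - tail_prob i.

Lemma p_pos (i : nat) : 0 < p i.
Proof. now apply pbd_pos. Qed.

Lemma ex_series_p (n : nat) : ex_series (fun k => p (n + k)).
Proof.
  apply (ex_series_incr_n p n).
  exists 1; now apply pbd_total.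
Qed.

Lemma ex_series_tail_mean (i : nat) :
  ex_series (fun k => INR (S k) * p (S i + k)).
Proof.
  apply ex_series_dominated with
    (fun k => INR (S (i + k)) * p (S (i + k))).
  - intros n; assert (H := p_pos (S (i + n))).
    assert (H0 := pos_INR (S n)).
    assert (H1 : INR (S n) <= INR (S (i + n))) by (apply le_INR; lia).
    change (S i + n)%nat with (S (i + n)).
    split; [apply Rmult_le_pos; lra|].
    apply Rmult_le_compat_r; lra.
  - apply (ex_series_incr_n (fun k => INR (S k) * p (S k)) i).
    now apply ex_series_pbd_mean.
Qed.

Lemma tail_prob_S (i : nat) : tail_prob i = p (S i) + tail_prob (S i).
Proof.
  unfold tail_prob; rewrite Series_incr_1 by apply ex_series_p.
  rewrite Nat.add_0_r; f_equal; apply Series_ext; intros n.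
  f_equal; lia.
Qed.

Lemma tail_prob_nonneg (i : nat) : 0 <= tail_prob i.
Proof.
  apply Series_nonneg; [|apply ex_series_p].
  intros n; apply Rlt_le, p_pos.
Qed.

Lemma cdf_0 : cdf 0 = p 0.
Proof.
  assert (H := is_series_unique _ _ (pbd_total alpha beta Halpha Hbeta)).
  rewrite Series_incr_1 in H by (exists 1; now apply pbd_total).
  unfold cdf, tail_prob; simpl; lra.
Qed.

Lemma cdf_S (i : nat) : cdf (S i) = cdf i + p (S i).
Proof. unfold cdf; rewrite (tail_prob_S i); ring. Qed.

Lemma cdf_pos (i : nat) : 0 < cdf i.
Proof.
  induction i as [|i IH]; [rewrite cdf_0; apply p_pos|].
  rewrite cdf_S; pose proof (p_pos (S i)); lra.
Qed.

Lemma tail_mean_S (i : nat) : tail_mean i = tail_prob i + tail_mean (S i).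
Proof.
  unfold tail_mean, tail_prob.
  rewrite Series_incr_1 by apply ex_series_tail_mean.
  rewrite (Series_incr_1 (fun k => p (S i + k))) by apply ex_series_p.
  rewrite Rplus_assoc; f_equal; [simpl INR; ring|].
  rewrite <- Series_plus.
  - apply Series_ext; intros n.
    replace (S i + S n)%nat with (S (S i) + n)%nat by lia.
    rewrite (S_INR (S n)); ring.
  - apply ex_series_ext with (fun k => p (S (S i) + k)); [|apply ex_series_p].
    intros n; f_equal; lia.
  - apply ex_series_tail_mean.
Qed.

Lemma tail_mean_nonneg (i : nat) : 0 <= tail_mean i.
Proof.
  apply Series_nonneg; [|apply ex_series_tail_mean].
  intros n; apply Rmult_le_pos; [apply pos_INR | apply Rlt_le, p_pos].
Qed.

(* Sums [death_rate beta k * p k = alpha * p (k - 1)] over [k > i], using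
   [death_rate beta (i + l) >= death_rate beta i + l (beta + 2 i)]. *)
Lemma tail_mean_le (i : nat) :
  (beta + 2 * INR i) * tail_mean i + death_rate beta i * tail_prob i
  <= alpha * (p i + tail_prob i).
Proof.
  replace (p i + tail_prob i) with (Series (fun k => p (i + k))).
  2:{ rewrite Series_incr_1 by apply ex_series_p; rewrite Nat.add_0_r.
      unfold tail_prob; f_equal; apply Series_ext; intros n; f_equal; lia. }
  unfold tail_mean, tail_prob; rewrite <- !Series_scal_l, <- Series_plus.
  - apply Series_le.
    2: apply (ex_series_scal_l alpha (fun k => p (i + k))), ex_series_p.
    intros n; assert (Hp := p_pos (S i + n)).
    assert (Hi := pos_INR i); assert (Hn := pos_INR n).
    assert (HSn := pos_INR (S n)); assert (Hd := death_rate_nonneg i).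
    split.
    + assert (0 <= INR (S n) * p (S i + n)) by (apply Rmult_le_pos; lra).
      apply Rplus_le_le_0_compat; apply Rmult_le_pos; lra.
    + change (S i + n)%nat with (S (i + n)) in *.
      rewrite <- pbd_S.
      rewrite <- Rmult_assoc, <- Rmult_plus_distr_r.
      apply Rmult_le_compat_r; [lra|].
      unfold death_rate; rewrite !S_INR, plus_INR; nra.
  - apply (ex_series_scal_l (beta + 2 * INR i)
             (fun k => INR (S k) * p (S i + k))), ex_series_tail_mean.
  - apply (ex_series_scal_l (death_rate beta i) (fun k => p (S i + k))),
      ex_series_p.
Qed.

Lemma tail_prob_le_tail_mean (i : nat) : tail_prob i <= tail_mean i.
Proof. rewrite tail_mean_S; pose proof (tail_mean_nonneg (S i)); lra. Qed.

Definition mean : R := tail_mean 0.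

(* [E (i - X)^+] *)
Definition head_mean (i : nat) : R := tail_mean i - mean + INR i.

Lemma head_mean_S (i : nat) : head_mean (S i) = head_mean i + cdf i.
Proof.
  unfold head_mean, cdf; rewrite (tail_mean_S i), S_INR; ring.
Qed.

Lemma head_mean_0 : head_mean 0 = 0.
Proof. unfold head_mean, mean; simpl; ring. Qed.

Lemma head_mean_nonneg (i : nat) : 0 <= head_mean i.
Proof.
  induction i as [|i IH]; [rewrite head_mean_0; lra|].
  rewrite head_mean_S; pose proof (cdf_pos i); lra.
Qed.

(** * Ratios of distribution function and tails to the mass function *)

Definition cdf_ratio (i : nat) : R := cdf i / p i.
Definition tail_ratio (i : nat) : R := tail_prob i / p i.
Definition mean_ratio (i : nat) : R := tail_mean i / p i.

Lemma cdf_ratio_0 : cdf_ratio 0 = 1.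
Proof.
  unfold cdf_ratio; rewrite cdf_0; field; apply Rgt_not_eq, p_pos.
Qed.

Lemma p_S (i : nat) : p i = death_rate beta (S i) * p (S i) / alpha.
Proof.
  assert (H := pbd_S i); rewrite H; field; lra.
Qed.

Lemma cdf_ratio_S (i : nat) :
  alpha * cdf_ratio (S i) = alpha + death_rate beta (S i) * cdf_ratio i.
Proof.
  unfold cdf_ratio; rewrite cdf_S, (p_S i).
  assert (H := p_pos (S i)); assert (Hd := death_rate_S_pos beta i Hbeta).
  field; lra.
Qed.

Lemma tail_ratio_S (i : nat) :
  death_rate beta (S i) * tail_ratio i = alpha * (1 + tail_ratio (S i)).
Proof.
  unfold tail_ratio; rewrite (tail_prob_S i), (p_S i).
  assert (H := p_pos (S i)); assert (Hd := death_rate_S_pos beta i Hbeta).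
  field; lra.
Qed.

Lemma cdf_ratio_ge_1 (i : nat) : 1 <= cdf_ratio i.
Proof.
  induction i as [|i IH]; [rewrite cdf_ratio_0; lra|].
  assert (H := cdf_ratio_S i); assert (Hd := death_rate_nonneg (S i)).
  assert (0 <= death_rate beta (S i) * cdf_ratio i)
    by (apply Rmult_le_pos; lra).
  apply Rmult_le_reg_l with alpha; lra.
Qed.

Lemma tail_ratio_nonneg (i : nat) : 0 <= tail_ratio i.
Proof.
  apply Rle_mult_inv_pos; [apply tail_prob_nonneg | apply p_pos].
Qed.

(** Both the death rate and, by induction, the previous ratio increase in the recursion
    [cdf_ratio_S]. *)
Lemma cdf_ratio_mono (i : nat) : cdf_ratio i <= cdf_ratio (S i).
Proof.
  induction i as [|i IH].
  - rewrite cdf_ratio_0; apply cdf_ratio_ge_1.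
  - assert (H0 := cdf_ratio_S i); assert (H1 := cdf_ratio_S (S i)).
    assert (Hd := death_rate_nonneg (S i)); assert (Hi := pos_INR (S i)).
    rewrite (death_rate_S (S i)) in H1.
    assert (H2 : 0 <= (beta + 2 * INR (S i)) * cdf_ratio (S i))
      by (apply Rmult_le_pos; pose proof (cdf_ratio_ge_1 (S i)); lra).
    assert (H3 : death_rate beta (S i) * cdf_ratio i
                 <= death_rate beta (S i) * cdf_ratio (S i))
      by (apply Rmult_le_compat_l; lra).
    apply Rmult_le_reg_l with alpha; lra.
Qed.

Lemma cdf_ratio_convex (i : nat) : decr cdf_ratio (S i) <= decr cdf_ratio i.
Proof.
  unfold decr; induction i as [|i IH].
  - assert (H0 := cdf_ratio_S 0); assert (H1 := cdf_ratio_S 1).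
    assert (H2 := cdf_ratio_mono 0); rewrite cdf_ratio_0 in *.
    rewrite (death_rate_S 1) in H1; unfold death_rate in *; simpl INR in *.
    set (x := cdf_ratio 1) in *; set (y := cdf_ratio 2) in *.
    apply Rmult_le_reg_l with alpha; [assumption|].
    nra.
  - assert (H0 := cdf_ratio_S i); assert (H1 := cdf_ratio_S (S i)).
    assert (H2 := cdf_ratio_S (S (S i))).
    assert (M := cdf_ratio_mono (S i)); assert (M0 := cdf_ratio_mono i).
    assert (G := cdf_ratio_ge_1 (S (S i))).
    assert (Hi := pos_INR (S i)).
    assert (Hd := death_rate_nonneg (S i)).
    rewrite !death_rate_S, ?(S_INR (S i)) in H2; rewrite (death_rate_S (S i)) in H1.
    set (u := cdf_ratio i) in *; set (v := cdf_ratio (S i)) in *.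
    set (w := cdf_ratio (S (S i))) in *; set (x := cdf_ratio (S (S (S i)))) in *.
    rewrite <- (death_rate_S i) in H2.
    set (D := death_rate beta (S i)) in *; set (k := beta + 2 * INR (S i)) in *.
    apply Rmult_le_reg_l with alpha; [assumption|].
    (* Product rule for the second difference of death rate times ratio; the death rate has second
       difference [2]. Every term on the right is nonnegative. *)
    assert (E : alpha * (v - w) - alpha * (w - x)
      = D * ((u - v) - (v - w)) + 2 * (k * (w - v)) + 2 * w).
    { replace (beta + 2 * (INR (S i) + 1)) with (k + 2) in H2
        by (unfold k; ring).
      replace (alpha * (v - w) - alpha * (w - x))
        with (alpha * v - 2 * (alpha * w) + alpha * x) by ring.
      rewrite H0, H1, H2; ring. }
    assert (0 <= D * ((u - v) - (v - w))) by (apply Rmult_le_pos; lra).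
    assert (0 <= k * (w - v)) by (apply Rmult_le_pos; unfold k; lra).
    lra.
Qed.

Lemma cdf_tail_ratio (i : nat) :
  tail_ratio i * cdf i = cdf_ratio i * tail_prob i.
Proof.
  unfold tail_ratio, cdf_ratio; field; apply Rgt_not_eq, p_pos.
Qed.

Lemma tail_mean_ratio_le (i : nat) :
  (beta + 2 * INR i) * (mean_ratio i) + death_rate beta i * tail_ratio i
  <= alpha * (1 + tail_ratio i).
Proof.
  assert (Hp := p_pos i).
  replace (alpha * (1 + tail_ratio i))
    with (alpha * (p i + tail_prob i) / p i) by (unfold mean_ratio, tail_ratio; field; lra).
  replace ((beta + 2 * INR i) * (mean_ratio i)
           + death_rate beta i * tail_ratio i)
    with (((beta + 2 * INR i) * tail_mean i
           + death_rate beta i * tail_prob i) / p i)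
    by (unfold mean_ratio, tail_ratio; field; lra).
  apply Rmult_le_compat_r; [now apply Rlt_le, Rinv_0_lt_compat|].
  apply tail_mean_le.
Qed.

(** Bounding [tail_mean] below by [tail_prob] in [tail_mean_ratio_le] gives [(beta + 2 i + B i -
    alpha) (T/pi)(i) <= alpha], and for [i >= 2 alpha + 1] the coefficient is at least [i^2 / 2].
    Quadratic decay is what absorbs the factor [INR i - mean] in [extremal_eq]. *)
Lemma tail_ratio_decay (i : nat) :
  2 * alpha + 1 <= INR i -> INR i ^ 2 * tail_ratio i <= 2 * alpha.
Proof.
  intros Hi.
  assert (Hp := p_pos i); assert (Hb := tail_ratio_nonneg i).
  assert (H1 : tail_ratio i <= mean_ratio i).
  { apply Rmult_le_compat_r; [now apply Rlt_le, Rinv_0_lt_compat|].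
    apply tail_prob_le_tail_mean. }
  assert (H := tail_mean_ratio_le i); unfold death_rate in H.
  assert (H2 : (beta + 2 * INR i) * tail_ratio i
               <= (beta + 2 * INR i) * (mean_ratio i))
    by (apply Rmult_le_compat_l; lra).
  assert (H3 : 0 <= (INR i - 1) * (INR i - 1 - 2 * alpha) * tail_ratio i)
    by prod_nonneg.
  assert (H4 : 0 <= beta * INR i * tail_ratio i)
    by prod_nonneg.
  assert (H5 : 0 <= (beta + 3 * INR i) * tail_ratio i)
    by prod_nonneg.
  assert (H6 : 0 <= alpha * tail_ratio i * (INR i - 1))
    by prod_nonneg.
  nra.
Qed.

Lemma is_lim_seq_tail_ratio : is_lim_seq tail_ratio 0.
Proof.
  apply squeeze_const_div_INR with (2 * alpha) (2 * alpha + 1).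
  - apply tail_ratio_nonneg.
  - intros n Hn; assert (H := tail_ratio_decay n Hn).
    assert (0 <= INR n * (INR n - 1) * tail_ratio n)
      by (pose proof (tail_ratio_nonneg n); prod_nonneg).
    lra.
Qed.

(** For [i >= 1], subtract the recursions [tail_ratio_S] at [i - 1] and [i]. At [0] only one of them
    exists, which leaves a source there. *)
Lemma tail_ratio_gen (i : nat) :
  killed_gen 1 tail_ratio i
  = - match i with O => alpha * (1 + tail_ratio 0) | S _ => 0 end.
Proof.
  unfold killed_gen; assert (H := tail_ratio_S i).
  destruct i as [|i].
  - rewrite death_rate_0; unfold death_rate in H; simpl INR in *; simpl pred; lra.
  - assert (H1 := tail_ratio_S i); rewrite death_rate_S in H; simpl pred.
    lra.
Qed.

(** A nonnegative source carried by [0] stays nonnegative under [decr], and the new source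
    [2 * tail_ratio (S j)] is nonnegative, so the maximum principle applies. *)
Lemma tail_ratio_decr_nonneg (i : nat) : 0 <= decr tail_ratio i.
Proof.
  apply killed_gen_nonneg with 2; [lra | | ].
  - apply is_lim_seq_decr, is_lim_seq_tail_ratio.
  - intros j; replace 2 with (1 + 1) by ring.
    rewrite (killed_gen_decr _ _ _ tail_ratio_gen).
    assert (H := tail_ratio_nonneg (S j)).
    assert (H0 := tail_ratio_nonneg 0).
    assert (0 <= alpha * (1 + tail_ratio 0)) by (apply Rmult_le_pos; lra).
    unfold decr; destruct j; lra.
Qed.

Lemma tail_ratio_convex (i : nat) : 0 <= decr (decr tail_ratio) i.
Proof.
  apply killed_gen_nonneg with 3; [lra | | ].
  - apply is_lim_seq_decr, is_lim_seq_decr, is_lim_seq_tail_ratio.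
  - intros j; replace 3 with (1 + 1 + 1) by ring.
    rewrite (killed_gen_decr _ _ _ (killed_gen_decr _ _ _ tail_ratio_gen)).
    assert (H := tail_ratio_decr_nonneg (S j)).
    assert (H1 : decr tail_ratio (S j) = tail_ratio (S j) - tail_ratio (S (S j)))
      by reflexivity.
    assert (H0 := tail_ratio_nonneg 0).
    assert (0 <= alpha * (1 + tail_ratio 0)) by (apply Rmult_le_pos; lra).
    unfold decr at 1 2 3; destruct j; lra.
Qed.

(** * The extremal solution *)

(* [alpha] times the solution of Stein's equation for [f k = - k], at [i + 1]. *)
Definition extremal (i : nat) : R :=
  tail_ratio i * head_mean i + cdf_ratio i * tail_mean i.

Lemma extremal_0 : extremal 0 = mean.
Proof.
  unfold extremal; rewrite head_mean_0, cdf_ratio_0; unfold mean; ring.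
Qed.

(** Stein's equation for [f k = - k] at [i + 1], multiplied by [alpha]. After the ratio recursions
    are inserted, the cross terms cancel by [cdf_tail_ratio]. *)
Lemma extremal_S (i : nat) :
  alpha * extremal (S i)
  = death_rate beta (S i) * extremal i + alpha * (mean - INR (S i)).
Proof.
  unfold extremal.
  replace (alpha * (tail_ratio (S i) * head_mean (S i)
                    + cdf_ratio (S i) * tail_mean (S i)))
    with ((alpha * (1 + tail_ratio (S i)) - alpha) * head_mean (S i)
          + (alpha * cdf_ratio (S i)) * tail_mean (S i)) by ring.
  rewrite <- tail_ratio_S, cdf_ratio_S, head_mean_S.
  replace (tail_mean (S i)) with (tail_mean i - tail_prob i)
    by (rewrite (tail_mean_S i); ring).
  assert (H := cdf_tail_ratio i).
  assert (H1 : cdf i = 1 - tail_prob i) by reflexivity.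
  assert (H2 : head_mean i = tail_mean i - mean + INR i) by reflexivity.
  assert (H3 : mean = tail_mean i - head_mean i + INR i) by lra.
  rewrite H3, S_INR.
  transitivity (death_rate beta (S i)
      * (tail_ratio i * head_mean i + cdf_ratio i * tail_mean i)
    + death_rate beta (S i)
      * (tail_ratio i * cdf i - cdf_ratio i * tail_prob i)
    - alpha * (head_mean i + cdf i) + alpha * (tail_mean i - tail_prob i)).
  - ring.
  - rewrite H, H1; ring.
Qed.

Lemma mean_nonneg : 0 <= mean.
Proof. apply tail_mean_nonneg. Qed.

Lemma extremal_nonneg (i : nat) : 0 <= extremal i.
Proof.
  apply Rplus_le_le_0_compat; apply Rmult_le_pos.
  - apply tail_ratio_nonneg.
  - apply head_mean_nonneg.
  - pose proof (cdf_ratio_ge_1 i); lra.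
  - apply tail_mean_nonneg.
Qed.

(** The products of [tail_prob] and [tail_mean] cancel, and with them the growing [cdf_ratio]; decay
    can then be read off. *)
Lemma extremal_eq (i : nat) :
  extremal i = mean_ratio i + (INR i - mean) * tail_ratio i.
Proof.
  unfold extremal, mean_ratio, tail_ratio, cdf_ratio, head_mean, cdf.
  field; apply Rgt_not_eq, p_pos.
Qed.

Lemma is_lim_seq_extremal : is_lim_seq extremal 0.
Proof.
  (* The first two summands bound [n * mean_ratio n], using [tail_ratio n <= 2 alpha]; the third
     bounds [n^2 * tail_ratio n]. *)
  apply squeeze_const_div_INR
    with (alpha + 2 * alpha ^ 2 + 2 * alpha) (2 * alpha + 1).
  - apply extremal_nonneg.
  - intros n Hn; rewrite extremal_eq.
    assert (H := tail_ratio_decay n Hn).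
    assert (H1 := tail_mean_ratio_le n).
    assert (Hb := tail_ratio_nonneg n).
    assert (Ht : 0 <= mean_ratio n)
      by (apply Rle_mult_inv_pos; [apply tail_mean_nonneg | apply p_pos]).
    assert (Hd : 0 <= death_rate beta n * tail_ratio n)
      by (apply Rmult_le_pos; [apply death_rate_nonneg | assumption]).
    assert (H2 : tail_ratio n <= 2 * alpha).
    { assert (0 <= (INR n - 1) * (INR n + 1) * tail_ratio n)
        by prod_nonneg; lra. }
    assert (H3 : alpha * tail_ratio n <= alpha * (2 * alpha))
      by (apply Rmult_le_compat_l; lra).
    assert (H4 : 0 <= mean * tail_ratio n * INR n)
      by (pose proof mean_nonneg; prod_nonneg).
    assert (H5 : 0 <= (beta + INR n) * (mean_ratio n))
      by (apply Rmult_le_pos; lra).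
    lra.
Qed.

Lemma extremal_gen (i : nat) : killed_gen 1 extremal i = - alpha.
Proof.
  unfold killed_gen; assert (H := extremal_S i); rewrite death_rate_S in H.
  destruct i as [|i].
  - rewrite death_rate_0, extremal_0 in *; simpl INR in *; simpl pred; lra.
  - assert (H1 := extremal_S i); simpl pred; rewrite (S_INR (S i)) in H; lra.
Qed.

(** The constant source [alpha] disappears under [decr]. Each differencing then adds [2 c] with
    [c = 1, 2, 3], whence the coefficients [2], [2 + 4 = 6] and [6 + 6 = 12] here and below. The
    sums [1 + 1 + ...] match the form [c + 1] of [killed_gen_decr]. *)
Lemma extremal_decr_gen (i : nat) :
  killed_gen (1 + 1) (decr extremal) i = - (2 * extremal (S i)).
Proof.
  rewrite (killed_gen_decr 1 extremal (fun _ => alpha) extremal_gen).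
  unfold decr; ring.
Qed.

Lemma extremal_decr2_gen (i : nat) :
  killed_gen (1 + 1 + 1) (decr (decr extremal)) i
  = - (6 * decr extremal (S i)).
Proof.
  rewrite (killed_gen_decr (1 + 1) _ _ extremal_decr_gen).
  unfold decr; ring.
Qed.

Lemma extremal_decr3_gen (i : nat) :
  killed_gen (1 + 1 + 1 + 1) (decr (decr (decr extremal))) i
  = - (12 * decr (decr extremal) (S i)).
Proof.
  rewrite (killed_gen_decr (1 + 1 + 1) _ _ extremal_decr2_gen).
  unfold decr; ring.
Qed.

Lemma extremal_decr_nonneg (i : nat) : 0 <= decr extremal i.
Proof.
  apply killed_gen_nonneg with (1 + 1); [lra | | ].
  - apply is_lim_seq_decr, is_lim_seq_extremal.
  - intros j; rewrite extremal_decr_gen.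
    pose proof (extremal_nonneg (S j)); lra.
Qed.

Lemma extremal_decr2_nonneg (i : nat) : 0 <= decr (decr extremal) i.
Proof.
  apply killed_gen_nonneg with (1 + 1 + 1); [lra | | ].
  - do 2 apply is_lim_seq_decr; apply is_lim_seq_extremal.
  - intros j; rewrite extremal_decr2_gen.
    pose proof (extremal_decr_nonneg (S j)); lra.
Qed.

Lemma extremal_decr3_nonneg (i : nat) : 0 <= decr (decr (decr extremal)) i.
Proof.
  apply killed_gen_nonneg with (1 + 1 + 1 + 1); [lra | | ].
  - do 3 apply is_lim_seq_decr; apply is_lim_seq_extremal.
  - intros j; rewrite extremal_decr3_gen.
    pose proof (extremal_decr2_nonneg (S j)); lra.
Qed.

(** * Factorial moments *)

Definition falling (k q : nat) : R := rprod (fun j => INR k - INR j) q.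

Definition fact_moment (q : nat) : R := Series (fun k => falling k q * p k).

Lemma falling_SS (k q : nat) : falling (S k) (S q) = INR (S k) * falling k q.
Proof.
  unfold falling; induction q as [|q IH]; [simpl rprod; simpl INR at 2; ring|].
  change (rprod (fun j => INR (S k) - INR j) (S q) * (INR (S k) - INR (S q))
          = INR (S k) * (rprod (fun j => INR k - INR j) q * (INR k - INR q))).
  rewrite IH, !S_INR; ring.
Qed.

Lemma falling_0_S (q : nat) : falling 0 (S q) = 0.
Proof.
  unfold falling; induction q as [|q IH]; [simpl; ring|].
  change (rprod (fun j => INR 0 - INR j) (S q) * (INR 0 - INR (S q)) = 0).
  rewrite IH; ring.
Qed.

(** Factors with [j > k] are negative, but the product then also contains the zero factor [j = k];
    [falling_SS] handles this by induction on [k]. *)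
Lemma falling_nonneg (k q : nat) : 0 <= falling k q.
Proof.
  revert q; induction k as [|k IH]; intros [|q].
  - unfold falling; simpl; lra.
  - rewrite falling_0_S; lra.
  - unfold falling; simpl; lra.
  - rewrite falling_SS; apply Rmult_le_pos; [apply pos_INR | apply IH].
Qed.

Lemma falling_p_nonneg (k q : nat) : 0 <= falling k q * p k.
Proof.
  apply Rmult_le_pos; [apply falling_nonneg | apply Rlt_le, p_pos].
Qed.

(** Detailed balance, with the death rate at [k + 1] written as [(k + 1) ((beta + q) + (k - q))]. *)
Lemma falling_p_S (k q : nat) :
  alpha * (falling k q * p k)
  = (beta + INR q) * (falling (S k) (S q) * p (S k))
    + falling (S k) (S (S q)) * p (S k).
Proof.
  replace (alpha * (falling k q * p k)) with (falling k q * (alpha * p k))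
    by ring.
  rewrite <- pbd_S.
  change (falling (S k) (S (S q)))
    with (falling (S k) (S q) * (INR (S k) - INR (S q))).
  rewrite falling_SS; unfold death_rate; rewrite !S_INR; ring.
Qed.

Lemma ex_series_falling (q : nat) : ex_series (fun k => falling k q * p k).
Proof.
  induction q as [|q IH].
  - apply ex_series_ext with (fun k => p (0 + k)); [|apply ex_series_p].
    intros k; unfold falling; simpl; ring.
  - apply ex_series_incr_1.
    apply ex_series_dominated
      with (fun k => alpha / beta * (falling k q * p k)).
    + intros k; split; [apply falling_p_nonneg|].
      apply Rmult_le_reg_l with beta; [assumption|].
      replace (beta * (alpha / beta * (falling k q * p k)))
        with (alpha * (falling k q * p k)) by (field; lra).
      rewrite falling_p_S.
      assert (H1 := falling_p_nonneg (S k) (S q)).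
      assert (H2 := falling_p_nonneg (S k) (S (S q))).
      assert (H3 : 0 <= INR q * (falling (S k) (S q) * p (S k)))
        by (apply Rmult_le_pos; [apply pos_INR | assumption]).
      lra.
    + apply (ex_series_scal_l (alpha / beta) (fun k => falling k q * p k)), IH.
Qed.

Lemma fact_moment_S (q : nat) :
  alpha * fact_moment q
  = (beta + INR q) * fact_moment (S q) + fact_moment (S (S q)).
Proof.
  unfold fact_moment.
  rewrite (Series_incr_1 (fun k => falling k (S q) * p k))
    by apply ex_series_falling.
  rewrite (Series_incr_1 (fun k => falling k (S (S q)) * p k))
    by apply ex_series_falling.
  rewrite !falling_0_S, !Rmult_0_l, !Rplus_0_l, <- !Series_scal_l.
  rewrite <- Series_plus.
  - apply Series_ext; intros k; apply falling_p_S.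
  - apply (ex_series_scal_l (beta + INR q)
             (fun k => falling (S k) (S q) * p (S k))).
    apply (ex_series_incr_1 (fun k => falling k (S q) * p k)),
      ex_series_falling.
  - apply (ex_series_incr_1 (fun k => falling k (S (S q)) * p k)),
      ex_series_falling.
Qed.

Lemma fact_moment_nonneg (q : nat) : 0 <= fact_moment q.
Proof.
  apply Series_nonneg; [|apply ex_series_falling].
  intros k; apply falling_p_nonneg.
Qed.

Lemma fact_moment_0 : fact_moment 0 = 1.
Proof.
  rewrite <- (is_series_unique _ _ (pbd_total alpha beta Halpha Hbeta)).
  apply Series_ext; intros k; unfold falling; simpl; ring.
Qed.

Lemma fact_moment_1 : fact_moment 1 = mean.
Proof.
  unfold fact_moment; rewrite Series_incr_1 by apply ex_series_falling.
  rewrite falling_0_S, Rmult_0_l, Rplus_0_l.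
  apply Series_ext; intros k.
  rewrite falling_SS; unfold falling; simpl rprod.
  change (0 + S k)%nat with (S k); change (1 + k)%nat with (S k); ring.
Qed.

(** * Bounds on the mean *)

Lemma mean_plus_fact_moment_2 : alpha = beta * mean + fact_moment 2.
Proof.
  assert (H := fact_moment_S 0).
  rewrite fact_moment_0, fact_moment_1 in H; simpl INR in H; lra.
Qed.

Lemma beta_mean_le : beta * mean <= alpha.
Proof.
  pose proof mean_plus_fact_moment_2; pose proof (fact_moment_nonneg 2); lra.
Qed.

(** The right side minus the left is [alpha s - 2 t], with [s], [t] the second and third factorial
    moments; the moment recursion at [q = 2] makes it nonnegative. *)
Lemma mean_upper :
  mean * (2 * (beta ^ 2 + beta + alpha) + alpha * beta)
  <= alpha * (alpha + 2 * beta + 2).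
Proof.
  assert (E0 := mean_plus_fact_moment_2).
  assert (E1 := fact_moment_S 1); assert (E2 := fact_moment_S 2).
  rewrite fact_moment_1 in E1; simpl INR in E1, E2.
  assert (P3 := fact_moment_nonneg 3); assert (P4 := fact_moment_nonneg 4).
  set (s := fact_moment 2) in *; set (t := fact_moment 3) in *.
  assert (H : 0 <= beta * t) by prod_nonneg.
  assert (Hs : 2 * t <= alpha * s) by lra.
  assert (Em : alpha * mean = (beta + 1) * s + t) by lra.
  replace (mean * (2 * (beta ^ 2 + beta + alpha) + alpha * beta))
    with ((alpha + 2 * beta + 2) * (beta * mean) + 2 * (alpha * mean)) by ring.
  replace (beta * mean) with (alpha - s) by lra.
  rewrite Em; lra.
Qed.

(** The right side minus the left is [(beta - 1) alpha s + (alpha + 2) t]. The recursions at [q = 2]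
    and [q = 3] turn it into [(beta^2 + beta) t + (2 beta + 2) v + w], whatever the sign of
    [beta - 1]. *)
Lemma mean_lower :
  2 * alpha * (alpha + beta + 1)
  <= mean * (alpha * (alpha + 2) + 2 * beta * (alpha + beta + 1)).
Proof.
  assert (E0 := mean_plus_fact_moment_2).
  assert (E1 := fact_moment_S 1); assert (E2 := fact_moment_S 2).
  assert (E3 := fact_moment_S 3).
  rewrite fact_moment_1 in E1; simpl INR in E1, E2, E3.
  assert (P3 := fact_moment_nonneg 3); assert (P4 := fact_moment_nonneg 4).
  assert (P5 := fact_moment_nonneg 5).
  set (s := fact_moment 2) in *; set (t := fact_moment 3) in *.
  set (v := fact_moment 4) in *; set (w := fact_moment 5) in *.
  assert (Em : alpha * mean = (beta + 1) * s + t) by lra.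
  replace (mean * (alpha * (alpha + 2) + 2 * beta * (alpha + beta + 1)))
    with ((alpha + 2) * (alpha * mean)
          + 2 * (alpha + beta + 1) * (beta * mean)) by ring.
  replace (beta * mean) with (alpha - s) by lra.
  rewrite Em.
  assert (H1 : 0 <= beta * t) by prod_nonneg.
  assert (H2 : 0 <= beta * (beta * t)) by prod_nonneg.
  assert (H3 : 0 <= beta * v) by prod_nonneg.
  assert (H4 : (1 - beta) * (alpha * s) = (1 - beta) * ((beta + 2) * t + v))
    by (f_equal; lra).
  lra.
Qed.

Lemma mean_sqr_le : mean ^ 2 + (beta - 1) * mean <= alpha.
Proof.
  assert (E0 := mean_plus_fact_moment_2).
  (* The variance of [X], with [(k - mean)^2] expanded in falling factorials. *)
  assert (H : 0 <= Series (fun k => falling k 2 * p k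
                   + ((1 - 2 * mean) * (falling k 1 * p k)
                      + mean ^ 2 * (falling k 0 * p k)))).
  { apply Series_nonneg.
    - intros k; unfold falling; simpl rprod; simpl INR.
      replace (_ + _) with ((INR k - mean) ^ 2 * p k) by ring.
      apply Rmult_le_pos; [apply pow2_ge_0 | apply Rlt_le, p_pos].
    - apply (ex_series_plus (fun k => falling k 2 * p k));
        [apply ex_series_falling|].
      apply (ex_series_plus (fun k => (1 - 2 * mean) * (falling k 1 * p k))).
      + apply (ex_series_scal_l (1 - 2 * mean) (fun k => falling k 1 * p k)),
          ex_series_falling.
      + apply (ex_series_scal_l (mean ^ 2) (fun k => falling k 0 * p k)),
          ex_series_falling. }
  rewrite Series_plus, Series_plus, !Series_scal_l in H;
    try apply ex_series_falling;
    try (apply (ex_series_scal_l (1 - 2 * mean) (fun k => falling k 1 * p k)),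
          ex_series_falling);
    try (apply (ex_series_scal_l (mean ^ 2) (fun k => falling k 0 * p k)),
          ex_series_falling).
  2: { apply (ex_series_plus (fun k => (1 - 2 * mean) * (falling k 1 * p k))).
      + apply (ex_series_scal_l (1 - 2 * mean) (fun k => falling k 1 * p k)),
          ex_series_falling.
      + apply (ex_series_scal_l (mean ^ 2) (fun k => falling k 0 * p k)),
          ex_series_falling. }
  fold (fact_moment 2) (fact_moment 1) (fact_moment 0) in H.
  rewrite fact_moment_0, fact_moment_1 in H; lra.
Qed.

Lemma mean_le :
  1 / alpha * mean
  <= Rmin (1 / (beta + 2 * alpha / (alpha + 2 * beta + 2)))
          ((sqrt (alpha + (1 - beta) ^ 2 / 4) + (1 - beta) / 2) / alpha).
Proof.
  apply Rmin_glb.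
  - assert (H := mean_upper).
    replace (1 / (beta + 2 * alpha / (alpha + 2 * beta + 2)))
      with ((alpha + 2 * beta + 2)
            / (2 * (beta ^ 2 + beta + alpha) + alpha * beta)).
    2:{ field; assert (0 < alpha * beta) by now apply Rmult_lt_0_compat.
        assert (0 < beta * beta) by now apply Rmult_lt_0_compat.
        split; [nra|]; lra. }
    assert (0 < alpha * beta) by now apply Rmult_lt_0_compat.
    assert (0 < beta * beta) by now apply Rmult_lt_0_compat.
    apply Rle_div_intro_r; [lra|].
    apply Rmult_le_reg_l with alpha; [assumption|].
    replace (alpha * (1 / alpha * mean
               * (2 * (beta ^ 2 + beta + alpha) + alpha * beta)))
      with (mean * (2 * (beta ^ 2 + beta + alpha) + alpha * beta))
      by (field; lra).
    assumption.
  - replace (1 / alpha * mean) with (mean / alpha) by (field; lra).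
    apply Rmult_le_compat_r; [now apply Rlt_le, Rinv_0_lt_compat|].
    assert (H := mean_sqr_le).
    (* Complete the square in [mean_sqr_le]. *)
    assert (H1 : mean - (1 - beta) / 2 <= sqrt ((mean - (1 - beta) / 2) ^ 2)).
    { rewrite <- Rsqr_pow2, sqrt_Rsqr_abs; apply RRle_abs. }
    assert (H2 : sqrt ((mean - (1 - beta) / 2) ^ 2)
                 <= sqrt (alpha + (1 - beta) ^ 2 / 4))
      by (apply sqrt_le_1_alt; lra).
    lra.
Qed.

(** * Differences of the extremal solution at the left end *)

Lemma extremal_1 : alpha * extremal 1 = beta * mean + alpha * (mean - 1).
Proof.
  rewrite extremal_S, extremal_0; unfold death_rate; simpl INR; ring.
Qed.

(** The first difference is largest at [0], where it decreases in the mean, so [mean_lower]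
    applies. *)
Lemma extremal_decr_le (i : nat) :
  decr extremal i / alpha
  <= (alpha + 2) / (alpha * (alpha + 2) + 2 * beta * (alpha + beta + 1)).
Proof.
  apply Rle_trans with (decr extremal 0 / alpha).
  { apply Rmult_le_compat_r; [now apply Rlt_le, Rinv_0_lt_compat|].
    apply (decr_nonneg_antitone (decr extremal)), extremal_decr2_nonneg. }
  assert (E : decr extremal 0 / alpha = (alpha - beta * mean) / alpha ^ 2).
  { unfold decr; rewrite extremal_0.
    replace (extremal 1) with ((beta * mean + alpha * (mean - 1)) / alpha)
      by (rewrite <- extremal_1; field; lra).
    field; lra. }
  rewrite E; assert (H := mean_lower).
  assert (0 < alpha * alpha) by now apply Rmult_lt_0_compat.
  assert (0 < beta * (alpha + beta + 1)) by (apply Rmult_lt_0_compat; lra).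
  apply Rle_div_intro_r; [lra|].
  replace ((alpha - beta * mean) / alpha ^ 2
           * (alpha * (alpha + 2) + 2 * beta * (alpha + beta + 1)))
    with ((alpha - beta * mean)
           * (alpha * (alpha + 2) + 2 * beta * (alpha + beta + 1)) / alpha ^ 2)
    by (field; lra).
  apply Rle_div_intro_l; [lra|].
  assert (H2 : beta * (2 * alpha * (alpha + beta + 1))
    <= beta * (mean * (alpha * (alpha + 2) + 2 * beta * (alpha + beta + 1))))
    by (apply Rmult_le_compat_l; lra).
  lra.
Qed.

Lemma extremal_decr_le_inv (i : nat) : decr extremal i / alpha <= 1 / alpha.
Proof.
  apply Rle_trans with (1 := extremal_decr_le i).
  assert (0 < alpha * alpha) by now apply Rmult_lt_0_compat.
  assert (0 < beta * (alpha + beta + 1)) by (apply Rmult_lt_0_compat; lra).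
  apply Rle_div_intro_l; [lra|].
  replace (1 / alpha * (alpha * (alpha + 2) + 2 * beta * (alpha + beta + 1)))
    with (alpha + 2 + 2 * (beta * (alpha + beta + 1)) / alpha) by (field; lra).
  assert (0 < 2 * (beta * (alpha + beta + 1)) / alpha)
    by (apply Rdiv_lt_0_compat; lra).
  lra.
Qed.

(** The second difference is largest at [0], where it increases in the mean, so [mean_upper]
    applies. *)
Lemma extremal_decr2_le (i : nat) :
  decr (decr extremal) i / alpha
  <= 1 / (alpha + beta * (1 + beta + alpha / 2)).
Proof.
  apply Rle_trans with (decr (decr extremal) 0 / alpha).
  { apply Rmult_le_compat_r; [now apply Rlt_le, Rinv_0_lt_compat|].
    apply (decr_nonneg_antitone (decr (decr extremal))), extremal_decr3_nonneg. }
  assert (E : decr (decr extremal) 0 / alpha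
    = 2 * (mean * (beta ^ 2 + beta + alpha) - (beta + 1) * alpha) / alpha ^ 3).
  { assert (E2 := extremal_S 1).
    assert (E1 := extremal_1).
    replace (death_rate beta 2) with (2 * beta + 2) in E2
      by (unfold death_rate; simpl; ring).
    simpl INR in E2.
    assert (E3 : extremal 1 = (beta * mean + alpha * (mean - 1)) / alpha)
      by (rewrite <- E1; field; lra).
    assert (E4 : extremal 2
      = ((2 * beta + 2) * extremal 1 + alpha * (mean - (1 + 1))) / alpha)
      by (rewrite <- E2; field; lra).
    unfold decr; rewrite extremal_0, E4, E3; field; lra. }
  rewrite E; assert (H := mean_upper).
  assert (0 < alpha * beta) by now apply Rmult_lt_0_compat.
  assert (0 < beta * beta) by now apply Rmult_lt_0_compat.
  assert (0 < alpha ^ 3) by now apply pow_lt.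
  set (Q := beta ^ 2 + beta + alpha) in *.
  assert (HQ : 0 < Q) by (unfold Q; lra).
  replace (1 / (alpha + beta * (1 + beta + alpha / 2)))
    with (2 / (2 * Q + alpha * beta)) by (unfold Q; field; nra).
  apply Rle_div_intro_l; [assumption|].
  replace (2 / (2 * Q + alpha * beta) * alpha ^ 3)
    with (2 * alpha ^ 3 / (2 * Q + alpha * beta)) by (field; lra).
  apply Rle_div_intro_r; [lra|].
  assert (K2 : Q * (mean * (2 * Q + alpha * beta))
               <= Q * (alpha * (alpha + 2 * beta + 2)))
    by (apply Rmult_le_compat_l; lra).
  (* This splitting cancels the term [(beta + 1) * alpha] of the value at [0] and leaves only
     [alpha ^ 3]. *)
  assert (K3 : (alpha + 2 * beta + 2) * Q
               = (beta + 1) * (2 * Q + alpha * beta) + alpha ^ 2)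
    by (unfold Q; ring).
  assert (K4 : Q * (alpha * (alpha + 2 * beta + 2))
    = alpha * (beta + 1) * (2 * Q + alpha * beta) + alpha ^ 3).
  { replace (Q * (alpha * (alpha + 2 * beta + 2)))
      with (alpha * ((alpha + 2 * beta + 2) * Q)) by ring.
    rewrite K3; ring. }
  lra.
Qed.

(** * The extremal increment *)

Lemma p_cdf_ratio (i : nat) : p i * cdf_ratio i = 1 - tail_prob i.
Proof.
  unfold cdf_ratio, cdf; field; apply Rgt_not_eq, p_pos.
Qed.

(** Multiply [tail_mean_le] by [F/pi]; by the recursion for [F/pi] the terms in [T] collapse to
    [- B (a - a') t], which is at most [0] by monotonicity. *)
Lemma tail_mean_cdf_ratio_le (i : nat) :
  (beta + 2 * INR (S i)) * (tail_mean (S i) * cdf_ratio (S i)) <= alpha.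
Proof.
  assert (H := tail_mean_le (S i)).
  assert (E := cdf_ratio_S i); assert (M := cdf_ratio_mono i).
  assert (G := cdf_ratio_ge_1 (S i)); assert (C := p_cdf_ratio (S i)).
  assert (T := tail_prob_nonneg (S i)).
  assert (Hd := death_rate_nonneg (S i)).
  set (a := cdf_ratio (S i)) in *; set (a' := cdf_ratio i) in *.
  set (e := tail_mean (S i)) in *; set (t := tail_prob (S i)) in *.
  set (B := death_rate beta (S i)) in *.
  set (N := beta + 2 * INR (S i)) in *.
  assert (H1 : (N * e) * a <= (alpha * (p (S i) + t) - B * t) * a)
    by (apply Rmult_le_compat_r; lra).
  assert (H2 : (alpha * (p (S i) + t) - B * t) * a
               = alpha * (p (S i) * a) + (alpha * a - B * a) * t) by ring.
  rewrite C, E in H2.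
  assert (H3 : 0 <= B * (a - a') * t) by prod_nonneg.
  lra.
Qed.

(** When the death rate exceeds [alpha], the tail enters [tail_mean_le] with a negative sign, and
    bounding it below by its first term sharpens the estimate. *)
Lemma tail_mean_cdf_ratio_le_strong (i : nat) :
  alpha <= death_rate beta (S i) ->
  (beta + 2 * INR (S i)) * death_rate beta (S (S i))
    * (tail_mean (S i) * cdf_ratio (S i))
  <= alpha * (beta + 2 * INR (S i) + alpha).
Proof.
  intros HB; assert (H := tail_mean_le (S i)).
  assert (G := cdf_ratio_ge_1 (S i)); assert (C := p_cdf_ratio (S i)).
  assert (T := tail_prob_nonneg (S i)).
  assert (T1 := tail_prob_S (S i)); assert (T2 := tail_prob_nonneg (S (S i))).
  assert (E := pbd_S (S i)); assert (D := death_rate_S (S i)).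
  assert (Hd := death_rate_nonneg (S (S i))); assert (Hi := pos_INR (S i)).
  set (a := cdf_ratio (S i)) in *.
  set (e := tail_mean (S i)) in *; set (t := tail_prob (S i)) in *.
  set (B := death_rate beta (S i)) in *.
  set (B' := death_rate beta (S (S i))) in *.
  set (N := beta + 2 * INR (S i)) in *.
  assert (HN : 0 < N) by (unfold N; lra).
  assert (H0 : B' * p (S (S i)) <= B' * t)
    by (apply Rmult_le_compat_l; lra).
  assert (H1 : B' * (N * e) <= B' * (alpha * (p (S i) + t) - B * t))
    by (apply Rmult_le_compat_l; lra).
  assert (H2 : (B - alpha) * (alpha * p (S i)) <= (B - alpha) * (B' * t))
    by (apply Rmult_le_compat_l; lra).
  assert (H3 : B' * (N * e) <= alpha * (N + alpha) * p (S i)).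
  { apply Rle_trans with (1 := H1).
    replace (alpha * (N + alpha) * p (S i))
      with (B' * (alpha * p (S i)) - (B - alpha) * (alpha * p (S i)))
      by (rewrite D; ring).
    lra. }
  assert (H4 : B' * (N * e) * a <= alpha * (N + alpha) * p (S i) * a)
    by (apply Rmult_le_compat_r; lra).
  assert (H5 : alpha * (N + alpha) * (p (S i) * a) <= alpha * (N + alpha) * 1)
    by (apply Rmult_le_compat_l; [prod_nonneg | lra]).
  lra.
Qed.

(** By the recursion this is equivalent to [cdf_ratio i >= 1]. *)
Lemma cdf_ratio_increment_le (i : nat) :
  (cdf_ratio (S i) - cdf_ratio i) * (death_rate beta (S i) + alpha)
  <= cdf_ratio (S i) * death_rate beta (S i).
Proof.
  assert (E := cdf_ratio_S i); assert (G := cdf_ratio_ge_1 i).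
  assert (H : alpha * 1 <= alpha * cdf_ratio i)
    by (apply Rmult_le_compat_l; lra).
  lra.
Qed.

(** Reduces a bound on [alpha P] to polynomial inequalities: the weak estimate serves for
    [B <= alpha], the strong one for [alpha <= B]. *)
Lemma extremal_increment_le_of (c : R) (i : nat) :
  let B := death_rate beta (S i) in
  let N := beta + 2 * INR (S i) in
  0 <= c ->
  (B <= alpha -> c * B <= N * (B + alpha)) ->
  (alpha <= B -> c * (B * (N + alpha)) <= N * (B + N) * (B + alpha)) ->
  c * ((cdf_ratio (S i) - cdf_ratio i) * tail_mean (S i)) <= alpha.
Proof.
  intros B N Hc H1 H2.
  assert (HB : 0 < B) by now apply death_rate_S_pos.
  assert (HN : 0 < N) by (unfold N; pose proof (pos_INR (S i)); lra).
  assert (He := tail_mean_nonneg (S i)).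
  assert (HD := cdf_ratio_increment_le i); fold B in HD.
  assert (K1 := tail_mean_cdf_ratio_le i); fold N in K1.
  assert (K2 := tail_mean_cdf_ratio_le_strong i); fold N B in K2.
  rewrite death_rate_S in K2; fold N B in K2.
  set (D := cdf_ratio (S i) - cdf_ratio i) in *.
  set (a := cdf_ratio (S i)) in *; set (e := tail_mean (S i)) in *.
  assert (HDe : D * e * (B + alpha) <= B * (e * a)).
  { replace (D * e * (B + alpha)) with (D * (B + alpha) * e) by ring.
    replace (B * (e * a)) with (a * B * e) by ring.
    now apply Rmult_le_compat_r. }
  destruct (Rle_or_lt B alpha) as [Hle|Hlt].
  - specialize (H1 Hle).
    assert (HP : 0 < N * (B + alpha)) by (apply Rmult_lt_0_compat; lra).
    apply Rmult_le_reg_l with (1 := HP).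
    assert (L1 : c * N * (D * e * (B + alpha)) <= c * N * (B * (e * a)))
      by (apply Rmult_le_compat_l; [prod_nonneg | assumption]).
    assert (L2 : c * B * (N * (e * a)) <= c * B * alpha)
      by (apply Rmult_le_compat_l; [prod_nonneg | assumption]).
    assert (L3 : c * B * alpha <= N * (B + alpha) * alpha)
      by (apply Rmult_le_compat_r; lra).
    lra.
  - assert (Hle : alpha <= B) by lra; specialize (H2 Hle); specialize (K2 Hle).
    assert (HP : 0 < N * (B + N) * (B + alpha))
      by (repeat apply Rmult_lt_0_compat; lra).
    apply Rmult_le_reg_l with (1 := HP).
    assert (L1 : c * N * (B + N) * (D * e * (B + alpha))
                 <= c * N * (B + N) * (B * (e * a)))
      by (apply Rmult_le_compat_l; [prod_nonneg | assumption]).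
    assert (L2 : c * B * (N * (B + N) * (e * a))
                 <= c * B * (alpha * (N + alpha)))
      by (apply Rmult_le_compat_l; [prod_nonneg | assumption]).
    assert (L3 : c * (B * (N + alpha)) * alpha
                 <= N * (B + N) * (B + alpha) * alpha)
      by (apply Rmult_le_compat_r; lra).
    lra.
Qed.

Lemma extremal_increment_le_beta (i : nat) :
  2 * (beta + 1) * ((cdf_ratio (S i) - cdf_ratio i) * tail_mean (S i))
  <= alpha.
Proof.
  apply extremal_increment_le_of; [lra | |]; intros H;
    assert (HB := death_rate_S_pos beta i Hbeta);
    set (B := death_rate beta (S i)) in *;
    assert (Hi := pos_INR i); set (N := beta + 2 * INR (S i));
    assert (HcN : 2 * (beta + 1) <= 2 * N) by (unfold N; rewrite S_INR; lra).
  - apply Rle_trans with (2 * N * B); [apply Rmult_le_compat_r; lra|].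
    assert (0 <= N * (alpha - B)) by prod_nonneg; lra.
  - assert (HcB : 2 * (beta + 1) <= B + N).
    { unfold B, N, death_rate; rewrite S_INR.
      assert (0 <= beta * INR i) by prod_nonneg.
      assert (0 <= INR i * INR i) by prod_nonneg.
      lra. }
    (* Both sides are affine in [alpha], so it suffices to interpolate
       between [alpha = 0] and [alpha = B]. *)
    apply Rmult_le_reg_l with B; [assumption|].
    assert (L1 : 0 <= (B + N - 2 * (beta + 1)) * (B * (B - alpha) * N))
      by prod_nonneg.
    assert (L2 : 0 <= (2 * N - 2 * (beta + 1)) * (B * alpha * (N + B)))
      by prod_nonneg.
    lra.
Qed.

(** The two sides differ by [(beta - 1)^2]. *)
Lemma death_rate_S_le_sqr (i : nat) :
  4 * death_rate beta (S i) <= (beta + 2 * INR (S i) - 1) ^ 2.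
Proof.
  assert (H := pow2_ge_0 (beta - 1)).
  unfold death_rate; lra.
Qed.

Lemma extremal_increment_le_sqrt (i : nat) :
  2 * sqrt alpha * ((cdf_ratio (S i) - cdf_ratio i) * tail_mean (S i))
  <= alpha.
Proof.
  assert (Hr := sqrt_lt_R0 alpha Halpha).
  assert (Hr2 := sqrt_sqrt alpha (Rlt_le _ _ Halpha)).
  set (r := sqrt alpha) in *.
  assert (HB := death_rate_S_pos beta i Hbeta).
  assert (HN := death_rate_S_le_sqr i).
  assert (Hi := pos_INR i).
  assert (HN1 : 1 < beta + 2 * INR (S i)) by (rewrite S_INR; lra).
  apply extremal_increment_le_of; [lra | |]; intros H;
    set (B := death_rate beta (S i)) in *;
    set (N := beta + 2 * INR (S i)) in *.
  (* Since [B <= N^2], the claim follows from [2 (N r) B <= (N r)^2 + B^2]. *)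
  - apply Rmult_le_reg_l with N; [lra|].
    assert (L1 : 0 <= B * ((N - 1) ^ 2 - 4 * B)) by prod_nonneg.
    assert (L2 := pow2_ge_0 (N * r - B)).
    assert (L3 : 0 <= B * (2 * N - 1 + 3 * B)) by prod_nonneg.
    assert (L4 : N * (N * (B + alpha)) = N * N * B + N * N * (r * r))
      by (rewrite Hr2; ring).
    lra.
  (* Here [r^2 = alpha <= B] and [4 B <= (N - 1)^2]. *)
  - assert (H2 : 2 * r <= N).
    { apply Rle_trans with (N - 1); [|lra].
      apply Rsqr_incr_0; unfold Rsqr; lra. }
    apply Rle_trans with (N * (B * (N + alpha))).
    { apply Rmult_le_compat_r; [prod_nonneg | assumption]. }
    assert (0 <= N * B * B) by prod_nonneg.
    assert (0 <= N * N * alpha) by prod_nonneg.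
    lra.
Qed.

(** * Solutions of Stein's equation *)

Section Stein.

Variables f g : nat -> R.
Hypothesis Hf : Lip1 f.
Hypothesis Hg : stein_solution alpha beta f g.

Definition centered_tail (i : nat) : R :=
  Series (fun k => (f (S i + k)%nat - f i) * p (S i + k)).

(** [E [f(X) - f(i); X <= i]], written as the complement of the tail part. *)
Definition centered_head (i : nat) : R :=
  expect p f - f i - centered_tail i.

Lemma Lip1_increment (i k : nat) : Rabs (f (i + k)%nat - f i) <= INR k.
Proof.
  assert (H := Hf (i + k)%nat i).
  replace (INR (i + k) - INR i) with (INR k) in H by (rewrite plus_INR; ring).
  now rewrite (Rabs_pos_eq (INR k)) in H by apply pos_INR.
Qed.

Lemma centered_tail_term_le (i k : nat) :
  Rabs ((f (S i + k)%nat - f i) * p (S i + k)) <= INR (S k) * p (S i + k).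
Proof.
  assert (H := Lip1_increment i (S k)); assert (Hp := p_pos (S i + k)).
  replace (i + S k)%nat with (S i + k)%nat in H by lia.
  rewrite Rabs_mult, (Rabs_pos_eq (p (S i + k))) by lra.
  apply Rmult_le_compat_r; lra.
Qed.

Lemma ex_series_centered_tail (i : nat) :
  ex_series (fun k => (f (S i + k)%nat - f i) * p (S i + k)).
Proof.
  apply ex_series_Rabs, ex_series_dominated
    with (fun k => INR (S k) * p (S i + k)); [|apply ex_series_tail_mean].
  intros k; split; [apply Rabs_pos | apply centered_tail_term_le].
Qed.

Lemma centered_tail_le (i : nat) : Rabs (centered_tail i) <= tail_mean i.
Proof.
  apply Series_abs_le; [apply centered_tail_term_le|apply ex_series_tail_mean].
Qed.

Lemma centered_tail_S (i : nat) :
  centered_tail i = fwd_diff f i * tail_prob i + centered_tail (S i).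
Proof.
  assert (H : centered_tail i
    = Series (fun k => fwd_diff f i * p (S i + k)
                       + (f (S i + k)%nat - f (S i)) * p (S i + k))).
  { apply Series_ext; intros k; unfold fwd_diff; ring. }
  assert (Hex : ex_series (fun k => (f (S i + k)%nat - f (S i)) * p (S i + k))).
  { apply ex_series_incr_1.
    apply ex_series_ext with
      (fun k => (f (S (S i) + k)%nat - f (S i)) * p (S (S i) + k)).
    - intros k; replace (S i + S k)%nat with (S (S i) + k)%nat by lia.
      reflexivity.
    - apply ex_series_centered_tail. }
  rewrite H, Series_plus, Series_scal_l; [f_equal | | assumption].
  (* After recentering at [f (S i)] the term [k = 0] vanishes. *)
  - rewrite Series_incr_1 by assumption.
    rewrite Nat.add_0_r; unfold Rminus at 1.
    rewrite Rplus_opp_r, Rmult_0_l, Rplus_0_l.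
    apply Series_ext; intros k.
    replace (S i + S k)%nat with (S (S i) + k)%nat by lia; reflexivity.
  - apply (ex_series_scal_l (fwd_diff f i) (fun k => p (S i + k))),
      ex_series_p.
Qed.

Lemma centered_head_S (i : nat) :
  centered_head (S i) = centered_head i - fwd_diff f i * cdf i.
Proof.
  unfold centered_head, cdf; rewrite (centered_tail_S i).
  unfold fwd_diff; ring.
Qed.

Lemma centered_head_0 : centered_head 0 = 0.
Proof.
  assert (Hex : ex_series (fun k => f k * p k)).
  { apply ex_series_Rabs.
    apply ex_series_ext with (2 := ex_series_Lip1_pbd alpha beta f Halpha Hbeta Hf).
    intros k; rewrite Rabs_mult, (Rabs_pos_eq (p k)); [reflexivity|].
    apply Rlt_le, p_pos. }
  assert (H : centered_tail 0
    = Series (fun k => f (S k) * p (S k)) - f 0%nat * tail_prob 0).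
  { unfold tail_prob; rewrite <- Series_scal_l, <- Series_minus.
    - apply Series_ext; intros k; change (1 + k)%nat with (S k); ring.
    - now apply (ex_series_incr_1 (fun k => f k * p k)).
    - apply (ex_series_scal_l (f 0%nat) (fun k => p (1 + k))), ex_series_p. }
  assert (H0 := cdf_0); unfold cdf in H0.
  unfold centered_head, expect; rewrite H, Series_incr_1 by assumption.
  rewrite <- H0; ring.
Qed.

Lemma fwd_diff_Lip1_le (i : nat) : Rabs (fwd_diff f i) <= 1.
Proof.
  assert (H := Lip1_increment i 1); rewrite Nat.add_1_r in H; exact H.
Qed.

Lemma centered_head_le (i : nat) : Rabs (centered_head i) <= head_mean i.
Proof.
  induction i as [|i IH].
  - rewrite centered_head_0, head_mean_0, Rabs_R0; lra.
  - rewrite centered_head_S, head_mean_S.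
    assert (H := fwd_diff_Lip1_le i); assert (Hc := cdf_pos i).
    apply Rle_trans with (1 := Rabs_triang _ _).
    rewrite Rabs_Ropp, Rabs_mult, (Rabs_pos_eq (cdf i)) by lra.
    assert (Rabs (fwd_diff f i) * cdf i <= 1 * cdf i)
      by (apply Rmult_le_compat_r; lra).
    lra.
Qed.

(** Over [pi(i+1)] the numerator is [T(i+1) F(i) - F(i+1) T(i) = - pi(i+1)], because [F + T = 1]. *)
Lemma tail_ratio_cdf_S (i : nat) :
  tail_ratio (S i) * cdf i - cdf_ratio (S i) * tail_prob i = - 1.
Proof.
  assert (Hp := p_pos (S i)).
  unfold tail_ratio, cdf_ratio; rewrite cdf_S, (tail_prob_S i).
  assert (H : cdf i = 1 - p (S i) - tail_prob (S i))
    by (unfold cdf; rewrite (tail_prob_S i); ring).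
  rewrite H; field; lra.
Qed.

Lemma stein_solution_S (i : nat) :
  alpha * g (S i)
  = tail_ratio i * centered_head i - cdf_ratio i * centered_tail i.
Proof.
  destruct Hg as [_ Heq]; unfold birth_rate in Heq.
  induction i as [|i IH].
  - assert (H := Heq 0%nat); rewrite death_rate_0 in H.
    rewrite centered_head_0, cdf_ratio_0.
    assert (H0 := centered_head_0); unfold centered_head in H0; lra.
  - assert (H := Heq (S i)).
    apply Rmult_eq_reg_l with alpha; [|lra].
    replace (alpha * (alpha * g (S (S i))))
      with (alpha * (f (S i) - expect p f)
            + death_rate beta (S i) * (alpha * g (S i))).
    2:{ rewrite <- H; ring. }
    rewrite IH.
    assert (Ea := cdf_ratio_S i); assert (Eb := tail_ratio_S i).
    assert (Eh : centered_head i = centered_head (S i) + fwd_diff f i * cdf i)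
      by (rewrite centered_head_S; ring).
    assert (Ef : f (S i) - expect p f
                 = - centered_head (S i) - centered_tail (S i))
      by (unfold centered_head; ring).
    rewrite Ef.
    replace (alpha * (- centered_head (S i) - centered_tail (S i))
      + death_rate beta (S i)
        * (tail_ratio i * centered_head i - cdf_ratio i * centered_tail i))
      with (- alpha * (centered_head (S i) + centered_tail (S i))
        + (death_rate beta (S i) * tail_ratio i) * centered_head i
        - (alpha + death_rate beta (S i) * cdf_ratio i) * centered_tail i
        + alpha * centered_tail i) by ring.
    rewrite Eb, <- Ea, Eh, (centered_tail_S i).
    (* What multiplies [fwd_diff f i] is [- 1] plus [F + T = 1], hence zero. *)
    assert (Ek := tail_ratio_cdf_S i).
    assert (Ec : cdf i = 1 - tail_prob i) by reflexivity.
    transitivity (alpha * (tail_ratio (S i) * centered_head (S i)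
                           - cdf_ratio (S i) * centered_tail (S i))
      + alpha * fwd_diff f i
        * ((tail_ratio (S i) * cdf i - cdf_ratio (S i) * tail_prob i)
           + (cdf i + tail_prob i))).
    + ring.
    + rewrite Ek, Ec; ring.
Qed.

(** Recentering at [f (S i)] changes both products by the same amount, by [cdf_tail_ratio].
    Consecutive values of [g] can thus share one head and one tail of [f]. *)
Lemma stein_solution_S_next (i : nat) :
  alpha * g (S i)
  = tail_ratio i * centered_head (S i) - cdf_ratio i * centered_tail (S i).
Proof.
  rewrite stein_solution_S, centered_head_S, (centered_tail_S i).
  assert (H := cdf_tail_ratio i).
  replace (tail_ratio i * (centered_head i - fwd_diff f i * cdf i))
    with (tail_ratio i * centered_head i
          - fwd_diff f i * (tail_ratio i * cdf i)) by ring.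
  rewrite H; ring.
Qed.

Lemma Rabs_le_of_scaled (x m : R) : Rabs (alpha * x) <= m -> Rabs x <= m / alpha.
Proof.
  intros H; apply Rle_div_intro_r; [assumption|].
  rewrite Rabs_mult, (Rabs_pos_eq alpha) in H; lra.
Qed.

Lemma stein_solution_S_le (i : nat) : Rabs (alpha * g (S i)) <= extremal i.
Proof.
  rewrite stein_solution_S; apply Rabs_minus_le; apply Rabs_mult_le.
  - apply tail_ratio_nonneg.
  - apply centered_head_le.
  - pose proof (cdf_ratio_ge_1 i); lra.
  - apply centered_tail_le.
Qed.

Lemma stein_solution_le (i : nat) : Rabs (g i) <= mean / alpha.
Proof.
  assert (H : forall j, Rabs (g (S j)) <= mean / alpha).
  { intros j; apply Rabs_le_of_scaled.
    apply Rle_trans with (1 := stein_solution_S_le j).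
    rewrite <- extremal_0.
    apply decr_nonneg_antitone, extremal_decr_nonneg. }
  destruct i as [|i]; [rewrite (proj1 Hg)|]; apply H.
Qed.

Lemma extremal_next (i : nat) :
  extremal i
  = tail_ratio i * head_mean (S i) + cdf_ratio i * tail_mean (S i).
Proof.
  unfold extremal; rewrite head_mean_S, (tail_mean_S i).
  assert (H := cdf_tail_ratio i); lra.
Qed.

Lemma fwd_diff_0 : fwd_diff g 0 = 0.
Proof. unfold fwd_diff; rewrite (proj1 Hg); ring. Qed.

Lemma stein_fwd_diff_le (i : nat) :
  Rabs (alpha * fwd_diff g (S i))
  <= decr extremal i
     + 2 * ((cdf_ratio (S i) - cdf_ratio i) * tail_mean (S i)).
Proof.
  assert (Ha := cdf_ratio_mono i); assert (Hb := tail_ratio_decr_nonneg i).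
  unfold fwd_diff; rewrite Rmult_minus_distr_l.
  rewrite stein_solution_S, (stein_solution_S_next i).
  (* In [decr extremal] the tail term has a negative sign; adding it twice reverses that sign and
     gives the worst case for [f]. *)
  replace (decr extremal i
           + 2 * ((cdf_ratio (S i) - cdf_ratio i) * tail_mean (S i)))
    with (decr tail_ratio i * head_mean (S i)
          + (cdf_ratio (S i) - cdf_ratio i) * tail_mean (S i))
    by (unfold decr; rewrite (extremal_next i); unfold extremal; ring).
  rewrite <- Rabs_Ropp.
  replace (- _) with (decr tail_ratio i * centered_head (S i)
      - (cdf_ratio (S i) - cdf_ratio i) * - centered_tail (S i))
    by (unfold decr; ring).
  apply Rabs_minus_le; apply Rabs_mult_le; try lra.
  - apply centered_head_le.
  - rewrite Rabs_Ropp; apply centered_tail_le.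
Qed.

Lemma stein_fwd_diff_bound (i : nat) :
  Rabs (fwd_diff g i)
  <= Rmin (1 / (beta + 1)
           + (alpha + 2)
             / (alpha * (alpha + 2) + 2 * beta * (alpha + beta + 1)))
          (1 / sqrt alpha + 1 / alpha).
Proof.
  assert (Hr := sqrt_lt_R0 alpha Halpha).
  destruct i as [|i].
  { rewrite fwd_diff_0, Rabs_R0.
    assert (0 < beta * (alpha + beta + 1)) by (apply Rmult_lt_0_compat; lra).
    assert (0 < alpha * (alpha + 2)) by (apply Rmult_lt_0_compat; lra).
    apply Rmin_glb; apply Rplus_le_le_0_compat;
      apply Rle_mult_inv_pos; lra. }
  assert (H := Rabs_le_of_scaled _ _ (stein_fwd_diff_le i)).
  rewrite Rdiv_plus_distr in H.
  assert (Hc : forall c, 0 < c ->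
    c * ((cdf_ratio (S i) - cdf_ratio i) * tail_mean (S i)) <= alpha / 2 ->
    2 * ((cdf_ratio (S i) - cdf_ratio i) * tail_mean (S i)) / alpha <= 1 / c).
  { intros c Hc0 Hc; apply Rle_div_intro_r; [assumption|].
    replace (2 * _ / alpha * c) with
      (2 * (c * ((cdf_ratio (S i) - cdf_ratio i) * tail_mean (S i))) / alpha)
      by (field; lra).
    apply Rle_div_intro_l; lra. }
  assert (K1 := extremal_increment_le_beta i).
  assert (K2 := extremal_increment_le_sqrt i).
  assert (L1 := Hc (beta + 1) ltac:(lra) ltac:(lra)).
  assert (L2 := Hc (sqrt alpha) ltac:(lra) ltac:(lra)).
  assert (M1 := extremal_decr_le i); assert (M2 := extremal_decr_le_inv i).
  apply Rmin_glb; lra.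
Qed.

Lemma stein_fwd_diff2_le (i : nat) :
  Rabs (alpha * fwd_diff (fwd_diff g) (S i))
  <= decr (decr extremal) i + 2.
Proof.
  assert (Hf1 := fwd_diff_Lip1_le (S i)).
  assert (G0 := stein_solution_S_next i); assert (G1 := stein_solution_S (S i)).
  assert (G2 := stein_solution_S (S (S i))).
  assert (E0 := extremal_next i).
  assert (E2 : extremal (S (S i))
    = tail_ratio (S (S i)) * head_mean (S (S i))
      + cdf_ratio (S (S i)) * tail_mean (S (S i))) by reflexivity.
  assert (E1 : extremal (S i)
    = tail_ratio (S i) * head_mean (S i)
      + cdf_ratio (S i) * tail_mean (S i)) by reflexivity.
  rewrite centered_head_S in G2; rewrite head_mean_S in E2.
  rewrite (centered_tail_S (S i)) in G0, G1.
  rewrite (tail_mean_S (S i)) in E0, E1.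
  assert (Ek := tail_ratio_cdf_S (S i)).
  assert (Ha := cdf_ratio_convex i); assert (Hb := tail_ratio_convex i).
  assert (HA := centered_head_le (S i)).
  assert (HC := centered_tail_le (S (S i))).
  set (phi := fwd_diff f (S i)) in *.
  set (da := decr cdf_ratio i - decr cdf_ratio (S i)) in *.
  set (db := decr (decr tail_ratio) i) in *.
  (* The coefficient of [phi] once heads are centered at [S i] and tails at [S (S i)]. It appears as
     [- k] in [EE], where [phi = - 1]. *)
  set (k := 1 - da * tail_prob (S i)).
  assert (EG : alpha * fwd_diff (fwd_diff g) (S i)
    = db * centered_head (S i) - da * centered_tail (S (S i)) + phi * k).
  { unfold fwd_diff.
    replace (alpha * _) with (alpha * g (S (S (S i)))
      - 2 * (alpha * g (S (S i))) + alpha * g (S i)) by ring.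
    rewrite G0, G1, G2; unfold k, da, db, decr.
    assert (Ek' : tail_ratio (S (S i)) * cdf (S i)
              = cdf_ratio (S (S i)) * tail_prob (S i) - 1) by lra.
    replace (tail_ratio (S (S i)) * (centered_head (S i) - phi * cdf (S i)))
      with (tail_ratio (S (S i)) * centered_head (S i)
            - phi * (tail_ratio (S (S i)) * cdf (S i))) by ring.
    rewrite Ek'; ring. }
  assert (EE : decr (decr extremal) i
    = db * head_mean (S i) + da * tail_mean (S (S i)) - k).
  { unfold decr; rewrite E0, E1, E2; unfold k, da, db, decr.
    assert (Ek' : tail_ratio (S (S i)) * cdf (S i)
              = cdf_ratio (S (S i)) * tail_prob (S i) - 1) by lra.
    replace (tail_ratio (S (S i)) * (head_mean (S i) + cdf (S i)))
      with (tail_ratio (S (S i)) * head_mean (S i)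
            + tail_ratio (S (S i)) * cdf (S i)) by ring.
    rewrite Ek'; ring. }
  assert (Hda : 0 <= da) by (unfold da; lra).
  assert (Hk : k <= 1).
  { unfold k; assert (0 <= da * tail_prob (S i))
      by (apply Rmult_le_pos; [assumption | apply tail_prob_nonneg]); lra. }
  (* Only [k <= 1] is known, which gives [|k| <= 2 - k]; the [k] then cancels against [EE] and
     leaves the constant [2]. *)
  assert (Hphik : Rabs (phi * k) <= 2 - k).
  { rewrite Rabs_mult.
    assert (Rabs phi * Rabs k <= 1 * Rabs k)
      by (apply Rmult_le_compat_r; [apply Rabs_pos | assumption]).
    assert (Rabs k <= 2 - k) by (apply Rabs_le; lra).
    lra. }
  rewrite EG, EE.
  assert (H1 := Rabs_minus_le _ _ _ _
    (Rabs_mult_le db _ _ Hb HA) (Rabs_mult_le da _ _ Hda HC)).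
  apply Rle_trans with (1 := Rabs_triang _ _); lra.
Qed.

(** With [g 0 = g 1], the equations at [0] and [1] give [alpha Delta^2 g(0) = Delta f(0) + beta
    g(1)], and [beta mean <= alpha] bounds the last term by [1]. *)
Lemma stein_fwd_diff2_0_le :
  Rabs (alpha * fwd_diff (fwd_diff g) 0) <= 2.
Proof.
  assert (E0 := proj2 Hg 0%nat); assert (E1 := proj2 Hg 1%nat).
  unfold birth_rate in E0, E1; rewrite death_rate_0 in E0.
  replace (death_rate beta 1) with beta in E1
    by (unfold death_rate; simpl; ring).
  replace (alpha * fwd_diff (fwd_diff g) 0)
    with (fwd_diff f 0 - beta * - g 1%nat).
  2:{ unfold fwd_diff; rewrite (proj1 Hg); lra. }
  replace 2 with (1 + 1) by ring; apply Rabs_minus_le.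
  - apply fwd_diff_Lip1_le.
  - apply Rle_trans with (beta * (mean / alpha)).
    + apply Rabs_mult_le; [lra|].
      rewrite Rabs_Ropp; apply stein_solution_le.
    + replace (beta * (mean / alpha)) with (beta * mean / alpha)
        by (field; lra).
      apply Rle_div_intro_l; [assumption|].
      rewrite Rmult_1_l; apply beta_mean_le.
Qed.

Lemma stein_fwd_diff2_bound (i : nat) :
  Rabs (fwd_diff (fwd_diff g) i)
  <= 2 / alpha + 1 / (alpha + beta * (1 + beta + alpha / 2)).
Proof.
  assert (0 < beta * (1 + beta + alpha / 2))
    by (apply Rmult_lt_0_compat; lra).
  assert (0 <= 1 / (alpha + beta * (1 + beta + alpha / 2)))
    by (apply Rle_mult_inv_pos; lra).
  destruct i as [|i].
  - assert (H1 := Rabs_le_of_scaled _ _ stein_fwd_diff2_0_le); lra.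
  - assert (H1 := Rabs_le_of_scaled _ _ (stein_fwd_diff2_le i)).
    rewrite Rdiv_plus_distr in H1.
    assert (H2 := extremal_decr2_le i); lra.
Qed.

End Stein.

End Generator.

(** * Suprema over indices and over Lipschitz functions *)

Lemma sup_norm_le (u : nat -> R) (c : R) :
  (forall i, Rabs (u i) <= c) -> Rbar_le (sup_norm u) c.
Proof.
  intros H; apply (proj2 (is_sup_seq_lub _ _ (Sup_seq_correct _))).
  intros y [i E]; rewrite E; exact (H i).
Qed.

Lemma sup_norm_ge (u : nat -> R) (i : nat) : Rbar_le (Rabs (u i)) (sup_norm u).
Proof.
  exact (Sup_seq_minor_le (fun j => Finite (Rabs (u j))) (Rabs (u i)) i
           (Rle_refl _)).
Qed.

Lemma sup_Lip1_le (h : (nat -> R) -> Rbar) (c : Rbar) :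
  (forall f, Lip1 f -> Rbar_le (h f) c) -> Rbar_le (sup_Lip1 h) c.
Proof.
  intros H; unfold sup_Lip1, Rbar_lub.
  destruct Rbar_ex_lub as [l [Hub Hl]]; simpl; apply Hl.
  intros y [f [Hf E]]; rewrite E; now apply H.
Qed.

Lemma sup_Lip1_ge (h : (nat -> R) -> Rbar) (f : nat -> R) :
  Lip1 f -> Rbar_le (h f) (sup_Lip1 h).
Proof.
  intros Hf; unfold sup_Lip1, Rbar_lub.
  destruct Rbar_ex_lub as [l [Hl Hlub]]; simpl; apply Hl; now exists f.
Qed.

Lemma Lip1_INR : Lip1 INR.
Proof. intros x y; apply Rle_refl. Qed.

(** Shows that the bound on [g] is attained: the death rate vanishes at [0], so the equation there
    reads [alpha g(1) = - mean]. *)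
Lemma stein_solution_INR_1 (alpha beta : R) (g : nat -> R) :
  0 < alpha -> 0 < beta -> stein_solution alpha beta INR g ->
  Rabs (g 1%nat) = mean alpha beta / alpha.
Proof.
  intros Ha Hb [_ H]; specialize (H 0%nat).
  assert (E : expect (pbd alpha beta) INR = mean alpha beta).
  { rewrite <- fact_moment_1 by assumption.
    apply Series_ext; intros k; unfold falling; simpl; ring. }
  rewrite E, death_rate_0 in H; unfold birth_rate in H; simpl INR in H.
  assert (Hm := mean_nonneg alpha beta Ha Hb).
  replace (g 1%nat) with (- (mean alpha beta / alpha)).
  - rewrite Rabs_Ropp; apply Rabs_pos_eq, Rle_mult_inv_pos; assumption.
  - apply Rmult_eq_reg_l with alpha; [|lra].
    replace (alpha * - (mean alpha beta / alpha)) with (- mean alpha beta)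
      by (field; lra).
    lra.
Qed.

Theorem theorem1p1
  (alpha beta : R) (Halpha : 0 < alpha) (Hbeta : 0 < beta)
  (g : (nat -> R) -> nat -> R)
  (Hg : forall f : nat -> R, Lip1 f -> stein_solution alpha beta f (g f)) :
  (sup_Lip1 (fun f => sup_norm (g f))
     = Finite (1 / alpha * Series (fun k => INR (S k) * pbd alpha beta (S k)))
   /\ 1 / alpha * Series (fun k => INR (S k) * pbd alpha beta (S k))
      <= Rmin (1 / (beta + 2 * alpha / (alpha + 2 * beta + 2)))
              ((sqrt (alpha + (1 - beta) ^ 2 / 4) + (1 - beta) / 2) / alpha))
  /\
  Rbar_le (sup_Lip1 (fun f => sup_norm (fwd_diff (g f))))
    (Finite (Rmin (1 / (beta + 1)
                   + (alpha + 2)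
                     / (alpha * (alpha + 2) + 2 * beta * (alpha + beta + 1)))
                  (1 / sqrt alpha + 1 / alpha)))
  /\
  (Rbar_le (sup_Lip1 (fun f => sup_norm (fwd_diff (fwd_diff (g f)))))
     (Finite (2 / alpha + 1 / (alpha + beta * (1 + beta + alpha / 2))))
   /\ 2 / alpha + 1 / (alpha + beta * (1 + beta + alpha / 2)) <= 3 / alpha).
Proof.
  (* [mean] is [tail_mean 0], whose index [1 + k] reduces to [S k]. *)
  change (Series (fun k => INR (S k) * pbd alpha beta (S k)))
    with (mean alpha beta).
  split; [split|split; [|split]].
  - replace (1 / alpha * mean alpha beta) with (mean alpha beta / alpha)
      by (field; lra).
    apply Rbar_le_antisym.
    + apply sup_Lip1_le; intros f Hf; apply sup_norm_le.
      now apply (stein_solution_le alpha beta Halpha Hbeta f); [|apply Hg].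
    + rewrite <- (stein_solution_INR_1 alpha beta (g INR))
        by (try assumption; apply Hg, Lip1_INR).
      apply Rbar_le_trans with (1 := sup_norm_ge (g INR) 1).
      exact (sup_Lip1_ge (fun f => sup_norm (g f)) INR Lip1_INR).
  - now apply mean_le.
  - apply sup_Lip1_le; intros f Hf; apply sup_norm_le.
    now apply (stein_fwd_diff_bound alpha beta Halpha Hbeta f); [|apply Hg].
  - apply sup_Lip1_le; intros f Hf; apply sup_norm_le.
    now apply (stein_fwd_diff2_bound alpha beta Halpha Hbeta f); [|apply Hg].
  - replace (3 / alpha) with (2 / alpha + 1 / alpha) by (field; lra).
    assert (0 <= beta * (1 + beta + alpha / 2)) by prod_nonneg.
    apply Rplus_le_compat_l.
    unfold Rdiv; rewrite !Rmult_1_l; apply Rinv_le_contravar; lra.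
Qed.
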